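(* Let $H$ be a separable Hilbert space, $2\le p<\infty$, and $T$ a compact operator on $H$. The following are equivalent: (a) $T\in S_p$; (b) $\sum_{n=1}^\infty\sum_{k=1}^\infty|\langle Te_n,e_k\rangle|^p<\infty$ for every orthonormal basis $\{e_n\}$ of $H$; (c) $\sum_{n=1}^\infty\sum_{k=1}^\infty|\langle Tf_n,f_k\rangle|^p<\infty$ for every frame $\{f_n\}$ of $H$. Furthermore, there is a constant $c>0$ (depending only on $p$) such that for every $T\in S_p$, $$c\|T\|_p^p\le\sup\sum_{n,k}|\langle Te_n,e_k\rangle|^p\le\sup\sum_{n,k}|\langle Tf_n,f_k\rangle|^p\le\|T\|_p^p,$$ where the first supremum is over all orthonormal bases $\{e_n\}$ and the second over all frames $\{f_n\}$ with upper frame bound at most $1$.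
   Context: A sequence $\{f_n\}$ in $H$ is a frame if there are constants $0<C_1\le C_2$ such that $C_1\|f\|^2\le\sum_n|\langle f,f_n\rangle|^2\le C_2\|f\|^2$ for all $f\in H$. The upper frame bound is the infimum of all admissible $C_2$. For a compact operator $T$, its singular values $\lambda_1\ge\lambda_2\ge\cdots$ are the positive eigenvalues of $(T^*T)^{1/2}$, repeated according to multiplicity. For $0<p<\infty$, $S_p$ is the set of compact $T$ with $\{\lambda_n\}\in\ell^p$, and $\|T\|_p=(\sum_n\lambda_n^p)^{1/p}$. *)

(* Defs.v *)
From Stdlib Require Import Reals List.
Open Scope R_scope.

Record Cpx := mkC { re : R ; im : R }.
Definition C0 : Cpx := mkC 0 0.
Definition C1 : Cpx := mkC 1 0.
Definition Cadd (a b : Cpx) : Cpx := mkC (re a + re b) (im a + im b).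
Definition Cmul (a b : Cpx) : Cpx :=
  mkC (re a * re b - im a * im b) (re a * im b + im a * re b).
Definition Cconj (a : Cpx) : Cpx := mkC (re a) (- im a).
Definition Cmod (a : Cpx) : R := sqrt (re a * re a + im a * im a).
Definition RtoC (x : R) : Cpx := mkC x 0.

Record HilbertSpace := {
  hs :> Type;
  hzero : hs;
  hadd : hs -> hs -> hs;
  hopp : hs -> hs;
  hscal : Cpx -> hs -> hs;
  hinner : hs -> hs -> Cpx;
  hadd_assoc : forall x y z, hadd x (hadd y z) = hadd (hadd x y) z;
  hadd_comm : forall x y, hadd x y = hadd y x;
  hadd_zero : forall x, hadd x hzero = x;
  hadd_opp : forall x, hadd x (hopp x) = hzero;
  hscal_one : forall x, hscal C1 x = x;
  hscal_assoc : forall a b x, hscal a (hscal b x) = hscal (Cmul a b) x;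
  hscal_distr_v : forall a x y, hscal a (hadd x y) = hadd (hscal a x) (hscal a y);
  hscal_distr_c : forall a b x, hscal (Cadd a b) x = hadd (hscal a x) (hscal b x);
  hinner_add_l : forall x y z, hinner (hadd x y) z = Cadd (hinner x z) (hinner y z);
  hinner_scal_l : forall a x z, hinner (hscal a x) z = Cmul a (hinner x z);
  hinner_conj : forall x y, hinner y x = Cconj (hinner x y);
  hinner_pos : forall x, 0 <= re (hinner x x);
  hinner_def : forall x, hinner x x = C0 -> x = hzero;
  hcomplete : forall u : nat -> hs,
    (forall eps, eps > 0 -> exists N, forall m n, (m >= N)%nat -> (n >= N)%nat ->
        sqrt (re (hinner (hadd (u m) (hopp (u n))) (hadd (u m) (hopp (u n))))) < eps) ->
    exists l, forall eps, eps > 0 -> exists N, forall n, (n >= N)%nat ->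
        sqrt (re (hinner (hadd (u n) (hopp l)) (hadd (u n) (hopp l)))) < eps
}.

Arguments hzero {h}. Arguments hadd {h}. Arguments hopp {h}.
Arguments hscal {h}. Arguments hinner {h}.

Definition hsub {H : HilbertSpace} (x y : H) : H := hadd x (hopp y).
Definition hnorm {H : HilbertSpace} (x : H) : R := sqrt (re (hinner x x)).

Definition separable (H : HilbertSpace) : Prop :=
  exists d : nat -> H, forall x eps, eps > 0 -> exists n, hnorm (hsub x (d n)) < eps.

Definition linear_op {H : HilbertSpace} (T : H -> H) : Prop :=
  (forall x y, T (hadd x y) = hadd (T x) (T y)) /\
  (forall a x, T (hscal a x) = hscal a (T x)).

Definition compact_op {H : HilbertSpace} (T : H -> H) : Prop :=
  linear_op T /\
  forall u : nat -> H, (exists B, forall n, hnorm (u n) <= B) ->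
    exists (phi : nat -> nat) (l : H),
      (forall n, (phi n < phi (S n))%nat) /\
      forall eps, eps > 0 -> exists N, forall n, (n >= N)%nat ->
        hnorm (hsub (T (u (phi n))) l) < eps.

(* s is the sequence of singular values of T: the positive eigenvalues of
   A = (T^* T)^{1/2}, in nonincreasing order, repeated according to
   multiplicity, padded by zeros if there are only finitely many. *)
Definition singular_values {H : HilbertSpace} (T : H -> H) (s : nat -> R) : Prop :=
  exists (Tad A : H -> H),
    (forall x y, hinner (T x) y = hinner x (Tad y)) /\
    linear_op A /\
    (forall x y, hinner (A x) y = hinner x (A y)) /\
    (forall x, 0 <= re (hinner (A x) x)) /\
    (forall x, A (A x) = Tad (T x)) /\
    (forall n, 0 <= s (S n) <= s n) /\
    (* multiplicities: for each mu > 0 and each m, mu occurs at least m times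
       in s iff the mu-eigenspace of A has dimension at least m *)
    (forall mu, mu > 0 -> forall m : nat,
       (exists g : nat -> nat,
          (forall i j, (i < m)%nat -> (j < m)%nat -> g i = g j -> i = j) /\
          (forall i, (i < m)%nat -> s (g i) = mu))
       <->
       (exists e : nat -> H,
          (forall i j, (i < m)%nat -> (j < m)%nat ->
             hinner (e i) (e j) = if Nat.eq_dec i j then C1 else C0) /\
          (forall i, (i < m)%nat -> A (e i) = hscal (RtoC mu) (e i)))).

(* real power x^p for x >= 0 (with 0^p = 0 for p > 0) *)
Definition rpow (x p : R) : R := if Rle_dec x 0 then 0 else Rpower x p.

Definition in_Sp {H : HilbertSpace} (T : H -> H) (p : R) : Prop :=
  exists s, singular_values T s /\ exists L, infinite_sum (fun n => rpow (s n) p) L.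

(* nnsum_le f M : the (unordered) sum of the nonnegative family f is <= M *)
Definition nnsum_le {I : Type} (f : I -> R) (M : R) : Prop :=
  forall l : list I, NoDup l -> fold_right Rplus 0 (map f l) <= M.

Definition nnsum_finite {I : Type} (f : I -> R) : Prop := exists M, nnsum_le f M.

Definition orthonormal_basis {H : HilbertSpace} {I : Type} (e : I -> H) : Prop :=
  (forall i, hinner (e i) (e i) = C1) /\
  (forall i j, i <> j -> hinner (e i) (e j) = C0) /\
  (forall x, (forall i, hinner x (e i) = C0) -> x = hzero).

Definition frame_coeff_sum {H : HilbertSpace} (f : nat -> H) (x : H) : nat -> R :=
  fun n => Cmod (hinner x (f n)) ^ 2.

Definition is_frame {H : HilbertSpace} (f : nat -> H) : Prop :=
  exists C1' C2', 0 < C1' /\ C1' <= C2' /\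
    forall x, exists L, infinite_sum (frame_coeff_sum f x) L /\
      C1' * hnorm x ^ 2 <= L /\ L <= C2' * hnorm x ^ 2.

Definition admissible_upper_bound {H : HilbertSpace} (f : nat -> H) (C : R) : Prop :=
  forall x, exists L, infinite_sum (frame_coeff_sum f x) L /\ L <= C * hnorm x ^ 2.

(* the upper frame bound (infimum of admissible C2) is at most b *)
Definition upper_frame_bound_le {H : HilbertSpace} (f : nat -> H) (b : R) : Prop :=
  forall eps, eps > 0 -> admissible_upper_bound f (b + eps).

Definition matrix_p {H : HilbertSpace} {I : Type} (T : H -> H) (u : I -> H) (p : R)
  : I * I -> R :=
  fun nk => rpow (Cmod (hinner (T (u (fst nk))) (u (snd nk)))) p.

(* Main.v *)
(* Write [q = p / 2].  For a compact operator with right singular vectors [v_n] and singular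
   values [s_n], Jensen's inequality for the weights [|<f_j, v_n>|^2] gives
   [sum_j ||T f_j||^p <= C^q sum_n s_n^p] whenever [(f_j)] has Bessel bound [C], and then
   [sum_k |<T f_j, f_k>|^p <= (C ||T f_j||^2)^q]; this is the upper estimate, also for frames.
   Conversely, split [T = T1 + i T2] into its real and imaginary parts.  In an eigenbasis of
   [T1] the diagonal entries [<T e, e>] dominate the eigenvalues of [T1], so by the same Jensen
   estimate [sum_n ||T1 v_n||^p] is at most the diagonal sum of [|<T e, e>|^p]; likewise for
   [T2], and [s_n = ||T v_n||] yields the lower estimate with [c = 4^(-q)]. *)

From mathcomp Require classical_sets.
From Stdlib Require Import Reals List Lra Lia Classical ClassicalEpsilon ProofIrrelevance.
Require Import Defs.
Open Scope R_scope.
Set Bullet Behavior "Strict Subproofs".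

(** Two features of the definitions shape the proof. Singular values are given only through the
    eigenvalue multiplicities of the positive root [A], with no indexing tied to eigenvectors; sums
    over [s] and sums over an eigenbasis are therefore compared by counting the positions of each
    positive value and matching finite lists. Orthonormal bases have arbitrary index types, finite
    ones included; separability injects such a type into [nat], and the gaps are filled by zero
    vectors, which add nothing to any sum and still leave a frame with both bounds equal to 1. The
    hypothesis [2 <= p] enters as [q >= 1], twice: in the tangent inequality for the convex function
    x^q, which stands in for Jensen, and in the inclusion of l^1 in l^q along each matrix row.
    Bounds are proved for finite sums, uniformly in their length, so no infinite double series is
    ever rearranged. The real and imaginary parts of [T] have different eigenbases in general, so
    the lower estimate applies its hypothesis to two bases. *)

Lemma Un_cv_const (a : R) : Un_cv (fun _ => a) a.
Proof. intros eps He; exists 0%nat; intros; unfold Rdist; rewrite Rminus_diag, Rabs_R0; lra. Qed.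

Lemma Un_cv_ext (u v : nat -> R) l : (forall n, u n = v n) -> Un_cv u l -> Un_cv v l.
Proof. intros E C eps He; destruct (C eps He) as [N HN]; exists N; intros; rewrite <- E; auto. Qed.

(** * Inner product algebra *)

Lemma Cpx_ext (a b : Cpx) : re a = re b -> im a = im b -> a = b.
Proof. destruct a, b; simpl; intros; subst; reflexivity. Qed.

(** The squared modulus is polynomial in the two parts, so [ring] and [nra] apply to it, unlike
    [Cmod]; [nsq] plays the same role for [hnorm]. *)
Definition Cn2 (a : Cpx) : R := re a * re a + im a * im a.

Lemma Cn2_pos (a : Cpx) : 0 <= Cn2 a.
Proof. unfold Cn2; nra. Qed.

Lemma Cn2_mul (a b : Cpx) : Cn2 (Cmul a b) = Cn2 a * Cn2 b.
Proof. unfold Cn2; simpl; ring. Qed.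

Lemma Cmod_pow2 (a : Cpx) : Cmod a ^ 2 = Cn2 a.
Proof.
  unfold Cmod. rewrite <- Rsqr_pow2, Rsqr_sqrt; [reflexivity | apply Cn2_pos].
Qed.

Definition nsq {H : HilbertSpace} (x : H) : R := re (hinner x x).

Section InnerProduct.
Context {H : HilbertSpace}.
Implicit Types (x y z : H) (a b : Cpx).

Lemma inner_conj_re x y : re (hinner y x) = re (hinner x y).
Proof. rewrite hinner_conj; reflexivity. Qed.

Lemma inner_conj_im x y : im (hinner y x) = - im (hinner x y).
Proof. rewrite hinner_conj; reflexivity. Qed.

Lemma inner_im_self x : im (hinner x x) = 0.
Proof. pose proof (inner_conj_im x x); lra. Qed.

Lemma inner_self x : hinner x x = RtoC (nsq x).
Proof. apply Cpx_ext; [reflexivity | apply inner_im_self]. Qed.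

Lemma inner_zero_l z : hinner (hzero : H) z = C0.
Proof.
  pose proof (hinner_add_l H hzero hzero z) as E.
  rewrite hadd_zero in E.
  assert (Er := f_equal re E); assert (Ei := f_equal im E); simpl in *.
  apply Cpx_ext; simpl; lra.
Qed.

Lemma inner_opp_l x z : hinner (hopp x) z = mkC (- re (hinner x z)) (- im (hinner x z)).
Proof.
  pose proof (hinner_add_l H x (hopp x) z) as E.
  rewrite hadd_opp, inner_zero_l in E.
  assert (Er := f_equal re E); assert (Ei := f_equal im E); simpl in *.
  apply Cpx_ext; simpl; lra.
Qed.

Lemma inner_add_r x y z : hinner z (hadd x y) = Cadd (hinner z x) (hinner z y).
Proof.
  apply Cpx_ext; simpl.
  - rewrite (inner_conj_re (hadd x y)), hinner_add_l; simpl.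
    rewrite (inner_conj_re z x), (inner_conj_re z y); ring.
  - rewrite (inner_conj_im (hadd x y)), hinner_add_l; simpl.
    rewrite (inner_conj_im z x), (inner_conj_im z y); ring.
Qed.

Lemma inner_scal_r a x z : hinner z (hscal a x) = Cmul (Cconj a) (hinner z x).
Proof.
  apply Cpx_ext; simpl.
  - rewrite (inner_conj_re (hscal a x)), hinner_scal_l; simpl.
    rewrite (inner_conj_re z x), (inner_conj_im z x); ring.
  - rewrite (inner_conj_im (hscal a x)), hinner_scal_l; simpl.
    rewrite (inner_conj_re z x), (inner_conj_im z x); ring.
Qed.

Lemma inner_zero_r z : hinner z (hzero : H) = C0.
Proof.
  rewrite hinner_conj, inner_zero_l; apply Cpx_ext; simpl; ring.
Qed.

Lemma inner_opp_r x z : hinner z (hopp x) = mkC (- re (hinner z x)) (- im (hinner z x)).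
Proof.
  apply Cpx_ext; simpl.
  - rewrite (inner_conj_re (hopp x)), inner_opp_l; simpl. rewrite (inner_conj_re z x); ring.
  - rewrite (inner_conj_im (hopp x)), inner_opp_l; simpl. rewrite (inner_conj_im z x); ring.
Qed.

End InnerProduct.

Global Hint Rewrite @hinner_add_l @hinner_scal_l @inner_zero_l @inner_opp_l
  @inner_add_r @inner_scal_r @inner_zero_r @inner_opp_r : inner.

Section Norm.
Context {H : HilbertSpace}.
Implicit Types (x y z : H) (a b : Cpx).

Lemma nsq_pos x : 0 <= nsq x.
Proof. apply hinner_pos. Qed.

Lemma nsq_eq0 x : nsq x = 0 -> x = hzero.
Proof.
  intro E; apply hinner_def; apply Cpx_ext; [exact E | apply inner_im_self].
Qed.

Lemma sub_eq0 x y : hsub x y = hzero -> x = y.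
Proof.
  intro E. rewrite <- (hadd_zero H x), <- (hadd_opp H y), (hadd_comm H y), hadd_assoc.
  unfold hsub in E; rewrite E, hadd_comm; apply hadd_zero.
Qed.

Lemma inner_ext x y : (forall z, hinner x z = hinner y z) -> x = y.
Proof.
  intro E; apply sub_eq0, nsq_eq0; unfold nsq, hsub.
  rewrite hinner_add_l, inner_opp_l, E; simpl; ring.
Qed.

End Norm.

(* Identities between vectors are checked on their inner products with an arbitrary vector. *)
Ltac hext :=
  apply inner_ext; let z := fresh "z" in intro z; unfold hsub, RtoC, C1, C0;
  autorewrite with inner; apply Cpx_ext; simpl.

(** * Cauchy-Schwarz and the triangle inequality *)

Section Norm2.
Context {H : HilbertSpace}.
Implicit Types (x y z : H) (a b : Cpx).

Lemma nsq_zero : nsq (hzero : H) = 0.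
Proof. unfold nsq; rewrite inner_zero_l; reflexivity. Qed.

Lemma nsq_scal a x : nsq (hscal a x) = Cn2 a * nsq x.
Proof.
  unfold nsq, Cn2; autorewrite with inner; simpl. rewrite (inner_im_self x); ring.
Qed.

Lemma nsq_add x y : nsq (hadd x y) = nsq x + 2 * re (hinner x y) + nsq y.
Proof.
  unfold nsq; autorewrite with inner; simpl. rewrite (inner_conj_re x y); ring.
Qed.

Lemma nsq_sub x y : nsq (hsub x y) = nsq x - 2 * re (hinner x y) + nsq y.
Proof.
  unfold nsq, hsub; autorewrite with inner; simpl. rewrite (inner_conj_re x y); ring.
Qed.

Lemma nsq_sub_sym x y : nsq (hsub x y) = nsq (hsub y x).
Proof. rewrite !nsq_sub, (inner_conj_re x y); ring. Qed.

Lemma cauchy_schwarz x y : Cn2 (hinner x y) <= nsq x * nsq y.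
Proof.
  destruct (Req_dec (nsq y) 0) as [E|E].
  - apply nsq_eq0 in E; subst y. rewrite inner_zero_r, nsq_zero; unfold Cn2; simpl; lra.
  (* The squared norm expands to [nsq y * (nsq x * nsq y - Cn2 (hinner x y))]; scaling [x] by
     [nsq y] avoids a division. *)
  - assert (P := nsq_pos (hsub (hscal (RtoC (nsq y)) x) (hscal (hinner x y) y))).
    rewrite nsq_sub, !nsq_scal in P. autorewrite with inner in P.
    unfold Cn2 in *; simpl in P. assert (Py := nsq_pos y). nra.
Qed.

Lemma norm_pos x : 0 <= hnorm x.
Proof. apply sqrt_pos. Qed.

Lemma norm_sqr x : hnorm x * hnorm x = nsq x.
Proof. apply sqrt_sqrt, nsq_pos. Qed.

Lemma norm_pow2 x : hnorm x ^ 2 = nsq x.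
Proof. rewrite <- norm_sqr; ring. Qed.

Lemma norm_le_of_nsq x B : 0 <= B -> nsq x <= B * B -> hnorm x <= B.
Proof.
  intros HB L; rewrite <- norm_sqr in L. assert (P := norm_pos x). nra.
Qed.

Lemma cauchy_schwarz_norm x y : Cmod (hinner x y) <= hnorm x * hnorm y.
Proof.
  unfold hnorm. rewrite <- sqrt_mult by apply nsq_pos.
  apply sqrt_le_1_alt, cauchy_schwarz.
Qed.

Lemma Cmod_re a : Rabs (re a) <= Cmod a.
Proof.
  rewrite <- sqrt_Rsqr_abs; apply sqrt_le_1_alt; unfold Rsqr; nra.
Qed.

Lemma Cmod_im a : Rabs (im a) <= Cmod a.
Proof.
  rewrite <- sqrt_Rsqr_abs; apply sqrt_le_1_alt; unfold Rsqr; nra.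
Qed.

Lemma norm_triangle x y : hnorm (hadd x y) <= hnorm x + hnorm y.
Proof.
  assert (Px := norm_pos x); assert (Py := norm_pos y).
  apply norm_le_of_nsq; [lra|].
  rewrite nsq_add. assert (L := cauchy_schwarz_norm x y).
  assert (L2 := Cmod_re (hinner x y)). assert (L3 := Rle_abs (re (hinner x y))).
  rewrite <- (norm_sqr x), <- (norm_sqr y). nra.
Qed.

Lemma norm_sub_sym x y : hnorm (hsub x y) = hnorm (hsub y x).
Proof. unfold hnorm; f_equal; apply nsq_sub_sym. Qed.

Lemma norm_sub_triangle x y z : hnorm (hsub x z) <= hnorm (hsub x y) + hnorm (hsub y z).
Proof.
  replace (hsub x z) with (hadd (hsub x y) (hsub y z)) by (hext; ring).
  apply norm_triangle.
Qed.

Lemma norm_eq0 x : hnorm x = 0 -> x = hzero.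
Proof. intro E; apply nsq_eq0; rewrite <- norm_sqr, E; ring. Qed.

Lemma norm_scal a x : hnorm (hscal a x) = Cmod a * hnorm x.
Proof.
  unfold hnorm. fold (nsq (hscal a x)). rewrite nsq_scal.
  apply sqrt_mult; [apply Cn2_pos | apply nsq_pos].
Qed.

Lemma normalize x : x <> hzero ->
  exists r, 0 < r /\ r * hnorm x = 1 /\ hinner (hscal (RtoC r) x) (hscal (RtoC r) x) = C1.
Proof.
  intro N. assert (P : 0 < hnorm x).
  { destruct (norm_pos x) as [?|E]; [assumption|]. symmetry in E; apply norm_eq0 in E; easy. }
  exists (/ hnorm x). split; [apply Rinv_0_lt_compat; lra|]. split; [field; lra|].
  rewrite inner_self, nsq_scal; apply Cpx_ext; simpl; [|reflexivity].
  rewrite <- norm_sqr; unfold Cn2; simpl; field; lra.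
Qed.

(** * Convergence in norm *)

Definition hcv (u : nat -> H) (l : H) : Prop :=
  forall eps, eps > 0 -> exists N, forall n, (n >= N)%nat -> hnorm (hsub (u n) l) < eps.

Lemma hcv_squeeze (u v : nat -> H) l m K : 0 <= K -> hcv u l ->
  (forall n, hnorm (hsub (v n) m) <= K * hnorm (hsub (u n) l)) -> hcv v m.
Proof.
  intros HK C L eps He.
  destruct (C (eps / (K + 1))) as [N HN].
  { apply Rdiv_lt_0_compat; lra. }
  exists N; intros n Hn. specialize (HN n Hn).
  eapply Rle_lt_trans; [apply L|].
  assert (P := norm_pos (hsub (u n) l)).
  apply (Rmult_lt_compat_l (K + 1)) in HN; [|lra].
  replace ((K + 1) * (eps / (K + 1))) with eps in HN by (field; lra). nra.
Qed.

Lemma hcv_add (u v : nat -> H) l m : hcv u l -> hcv v m ->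
  hcv (fun n => hadd (u n) (v n)) (hadd l m).
Proof.
  intros C D eps He.
  destruct (C (eps / 2)) as [N HN]; [lra|]. destruct (D (eps / 2)) as [N' HN']; [lra|].
  exists (max N N'); intros n Hn.
  specialize (HN n ltac:(lia)); specialize (HN' n ltac:(lia)).
  replace (hsub (hadd (u n) (v n)) (hadd l m)) with (hadd (hsub (u n) l) (hsub (v n) m))
    by (hext; ring).
  eapply Rle_lt_trans; [apply norm_triangle | lra].
Qed.

Lemma hcv_scal a (u : nat -> H) l : hcv u l -> hcv (fun n => hscal a (u n)) (hscal a l).
Proof.
  intro C. apply (hcv_squeeze u _ l _ (Cmod a)); [apply sqrt_pos | assumption |].
  intro n. replace (hsub (hscal a (u n)) (hscal a l)) with (hscal a (hsub (u n) l))
    by (hext; ring).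
  rewrite norm_scal; lra.
Qed.

Lemma hcv_ext (u v : nat -> H) l : (forall n, u n = v n) -> hcv u l -> hcv v l.
Proof. intros E C eps He; destruct (C eps He) as [N HN]; exists N; intros; rewrite <- E; auto. Qed.

Lemma hcv_unique (u : nat -> H) l m : hcv u l -> hcv u m -> l = m.
Proof.
  intros C D. apply sub_eq0, norm_eq0.
  apply cond_eq; intros eps He. rewrite Rminus_0_r, Rabs_right by (apply Rle_ge, norm_pos).
  destruct (C (eps / 2)) as [N HN]; [lra|]. destruct (D (eps / 2)) as [N' HN']; [lra|].
  specialize (HN (max N N') ltac:(lia)); specialize (HN' (max N N') ltac:(lia)).
  rewrite norm_sub_sym in HN.
  eapply Rle_lt_trans; [apply (norm_sub_triangle _ (u (max N N'))) | lra].
Qed.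

Lemma hcv_sub_Un_cv (u : nat -> H) l : hcv u l -> Un_cv (fun n => hnorm (hsub (u n) l)) 0.
Proof.
  intros C eps He; destruct (C eps He) as [N HN]; exists N; intros n Hn.
  unfold Rdist; rewrite Rminus_0_r, Rabs_right by (apply Rle_ge, norm_pos); auto.
Qed.

Lemma hcv_inner (u : nat -> H) l z : hcv u l ->
  Un_cv (fun n => re (hinner (u n) z)) (re (hinner l z)) /\
  Un_cv (fun n => im (hinner (u n) z)) (im (hinner l z)).
Proof.
  intro C.
  assert (Key : forall eps, eps > 0 -> exists N, forall n, (n >= N)%nat ->
             Cmod (hinner (hsub (u n) l) z) < eps).
  { intros eps He. destruct (C (eps / (hnorm z + 1))) as [N HN].
    { apply Rdiv_lt_0_compat; [lra|]. assert (P := norm_pos z); lra. }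
    exists N; intros n Hn; specialize (HN n Hn).
    eapply Rle_lt_trans; [apply cauchy_schwarz_norm|].
    assert (P := norm_pos z). assert (P2 := norm_pos (hsub (u n) l)).
    apply (Rmult_lt_compat_l (hnorm z + 1)) in HN; [|lra].
    replace ((hnorm z + 1) * (eps / (hnorm z + 1))) with eps in HN by (field; lra). nra. }
  split; intros eps He; destruct (Key eps He) as [N HN]; exists N; intros n Hn;
    specialize (HN n Hn); unfold Rdist.
  - eapply Rle_lt_trans; [|exact HN]. eapply Rle_trans; [|apply Cmod_re].
    unfold hsub; autorewrite with inner; simpl; apply Req_le; f_equal; ring.
  - eapply Rle_lt_trans; [|exact HN]. eapply Rle_trans; [|apply Cmod_im].
    unfold hsub; autorewrite with inner; simpl; apply Req_le; f_equal; ring.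
Qed.

(** Carries an adjoint-type identity from partial sums to their limits; it serves adjoints, the
    symmetry of square roots, and the closedness of orthogonal complements. *)
Lemma inner_limit_eq (u v : nat -> H) l m x y : hcv u l -> hcv v m ->
  (forall n, hinner (u n) x = hinner y (v n)) -> hinner l x = hinner y m.
Proof.
  intros C D E. rewrite (hinner_conj H m y).
  destruct (hcv_inner u l x C) as [C1 C2]. destruct (hcv_inner v m y D) as [D1 D2].
  apply Cpx_ext; simpl.
  - apply (UL_sequence _ _ _ C1). intros eps He; destruct (D1 eps He) as [N HN].
    exists N; intros n Hn. rewrite E, inner_conj_re; auto.
  - apply (UL_sequence _ _ _ C2). apply CV_opp in D2.
    intros eps He; destruct (D2 eps He) as [N HN].
    exists N; intros n Hn. rewrite E, inner_conj_im; apply HN; auto.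
Qed.

(** Passes to the limit in [nsq (u n) = nsq (u n - l) + 2 re <u n, l> - nsq l]. *)
Lemma hcv_nsq (u : nat -> H) l : hcv u l -> Un_cv (fun n => nsq (u n)) (nsq l).
Proof.
  intro C. assert (D := hcv_sub_Un_cv u l C). assert (D2 := CV_mult _ _ _ _ D D).
  destruct (hcv_inner u l l C) as [E _].
  assert (F := CV_minus _ _ _ _ (CV_plus _ _ _ _ D2 (CV_mult _ _ _ _ (Un_cv_const 2) E))
    (Un_cv_const (nsq l))).
  replace (0 * 0 + 2 * re (hinner l l) - nsq l) with (nsq l) in F by (unfold nsq; ring).
  revert F; apply Un_cv_ext; intro n. rewrite norm_sqr, nsq_sub; ring.
Qed.

Lemma hcv_subseq (u : nat -> H) l (phi : nat -> nat) :
  (forall n, (phi n < phi (S n))%nat) -> hcv u l -> hcv (fun n => u (phi n)) l.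
Proof.
  intros Hp C eps He; destruct (C eps He) as [N HN]; exists N; intros n Hn; apply HN.
  assert (forall k, (phi k >= k)%nat) as G by (induction k; [lia | specialize (Hp k); lia]).
  specialize (G n); lia.
Qed.

Definition hcauchy (u : nat -> H) : Prop :=
  forall eps, eps > 0 -> exists N, forall m n, (m >= N)%nat -> (n >= N)%nat ->
    hnorm (hsub (u m) (u n)) < eps.

Lemma hcauchy_cv (u : nat -> H) : hcauchy u -> exists l, hcv u l.
Proof. exact (hcomplete H u). Qed.

Lemma hcv_cauchy (u : nat -> H) l : hcv u l -> hcauchy u.
Proof.
  intros C eps He. destruct (C (eps / 2)) as [N HN]; [lra|].
  exists N; intros m n Hm Hn. assert (A := HN m Hm); assert (B := HN n Hn).
  rewrite norm_sub_sym in B.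
  eapply Rle_lt_trans; [apply (norm_sub_triangle _ l) | lra].
Qed.

End Norm2.

(** * Finite sums *)

(** The bound is strict, so that, unlike with [sum_f_R0], the empty sum is available. *)
Fixpoint rsum (f : nat -> R) (n : nat) : R :=
  match n with O => 0 | S k => rsum f k + f k end.

Definition lsum {I : Type} (f : I -> R) (l : list I) : R := fold_right Rplus 0 (map f l).

Lemma rsum_le (f g : nat -> R) n : (forall i, (i < n)%nat -> f i <= g i) -> rsum f n <= rsum g n.
Proof.
  induction n; simpl; intros E; [lra|].
  assert (P := E n ltac:(lia)). assert (Q := IHn ltac:(intros; apply E; lia)). lra.
Qed.

Lemma rsum_ext (f g : nat -> R) n : (forall i, (i < n)%nat -> f i = g i) -> rsum f n = rsum g n.
Proof. intro E; apply Rle_antisym; apply rsum_le; intros; rewrite E; auto; lra. Qed.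

Lemma rsum_plus (f g : nat -> R) n : rsum (fun i => f i + g i) n = rsum f n + rsum g n.
Proof. induction n; simpl; [ring | rewrite IHn; ring]. Qed.

Lemma rsum_scal (f : nat -> R) c n : rsum (fun i => c * f i) n = c * rsum f n.
Proof. induction n; simpl; [ring | rewrite IHn; ring]. Qed.

Lemma rsum_zero n : rsum (fun _ => 0) n = 0.
Proof. induction n; simpl; lra. Qed.

Lemma rsum_pos (f : nat -> R) n : (forall i, 0 <= f i) -> 0 <= rsum f n.
Proof. intro P; rewrite <- (rsum_zero n); apply rsum_le; auto. Qed.

Lemma rsum_mono (f : nat -> R) m n : (forall i, 0 <= f i) -> (m <= n)%nat -> rsum f m <= rsum f n.
Proof. intros P L; induction L; simpl; [lra|]. specialize (P m0); lra. Qed.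

Lemma rsum_swap (F : nat -> nat -> R) m n :
  rsum (fun i => rsum (F i) n) m = rsum (fun j => rsum (fun i => F i j) m) n.
Proof.
  induction m; simpl; [symmetry; apply rsum_zero|]. rewrite IHm, <- rsum_plus; reflexivity.
Qed.

Lemma rsum_f_R0 (f : nat -> R) n : sum_f_R0 f n = rsum f (S n).
Proof. induction n; simpl in *; [ring | rewrite IHn; ring]. Qed.

Lemma infinite_sum_rsum (f : nat -> R) l : infinite_sum f l <-> Un_cv (rsum f) l.
Proof.
  split; intros C eps He; destruct (C eps He) as [N HN].
  - exists (S N); intros n Hn; destruct n as [|n]; [lia|].
    rewrite <- rsum_f_R0; apply HN; lia.
  - exists N; intros n Hn. rewrite rsum_f_R0; apply HN; lia.
Qed.

Lemma Un_cv_le_bound (u : nat -> R) l M N0 :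
  Un_cv u l -> (forall n, (n >= N0)%nat -> u n <= M) -> l <= M.
Proof.
  intros C B. apply le_epsilon; intros eps He. destruct (C eps He) as [N HN].
  specialize (HN (max N N0) ltac:(lia)); specialize (B (max N N0) ltac:(lia)).
  unfold Rdist in HN; apply Rabs_def2 in HN; lra.
Qed.

Lemma Un_cv_ge_bound (u : nat -> R) l M N0 :
  Un_cv u l -> (forall n, (n >= N0)%nat -> M <= u n) -> M <= l.
Proof.
  intros C B. apply le_epsilon; intros eps He. destruct (C eps He) as [N HN].
  specialize (HN (max N N0) ltac:(lia)); specialize (B (max N N0) ltac:(lia)).
  unfold Rdist in HN; apply Rabs_def2 in HN; lra.
Qed.

Lemma infinite_sum_ge_rsum (f : nat -> R) l n :
  (forall i, 0 <= f i) -> infinite_sum f l -> rsum f n <= l.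
Proof.
  intros P C; apply infinite_sum_rsum in C.
  apply (Un_cv_ge_bound _ _ _ n C). intros; apply rsum_mono; auto.
Qed.

Lemma infinite_sum_le_bound (f : nat -> R) l M :
  infinite_sum f l -> (forall n, rsum f n <= M) -> l <= M.
Proof. intros C B; apply infinite_sum_rsum in C; apply (Un_cv_le_bound _ _ _ 0 C); auto. Qed.

Lemma infinite_sum_of_bounded (f : nat -> R) M :
  (forall i, 0 <= f i) -> (forall n, rsum f n <= M) -> exists l, infinite_sum f l.
Proof.
  intros P B. destruct (growing_cv (rsum f)) as [l Hl].
  - intro n; simpl; specialize (P n); lra.
  - exists M; intros x [n ->]; auto.
  - exists l; apply infinite_sum_rsum; assumption.
Qed.

Lemma Un_cv_rsum (F : nat -> nat -> R) (l : nat -> R) K :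
  (forall j, (j < K)%nat -> Un_cv (F j) (l j)) ->
  Un_cv (fun n => rsum (fun j => F j n) K) (rsum l K).
Proof.
  induction K; intros C; simpl; [apply Un_cv_const|].
  apply (CV_plus (fun n => rsum (fun j => F j n) K) (F K)); [apply IHK; intros; apply C; lia|].
  apply C; lia.
Qed.

Lemma lsum_cons {I : Type} (f : I -> R) x l : lsum f (x :: l) = f x + lsum f l.
Proof. reflexivity. Qed.

Lemma lsum_app {I : Type} (f : I -> R) l l' : lsum f (l ++ l') = lsum f l + lsum f l'.
Proof. induction l; simpl; [unfold lsum; simpl; ring|]. rewrite !lsum_cons, IHl; ring. Qed.

Lemma lsum_seq (f : nat -> R) n : lsum f (seq 0 n) = rsum f n.
Proof. induction n; [reflexivity|]. rewrite seq_S, lsum_app, IHn; unfold lsum; simpl; ring. Qed.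

Lemma lsum_pos {I : Type} (f : I -> R) l : (forall i, 0 <= f i) -> 0 <= lsum f l.
Proof. intro P; induction l; [unfold lsum; simpl; lra|]. rewrite lsum_cons; specialize (P a); lra. Qed.

Lemma lsum_map {I J : Type} (g : I -> J) (f : J -> R) l : lsum f (map g l) = lsum (fun i => f (g i)) l.
Proof. unfold lsum; rewrite map_map; reflexivity. Qed.

Lemma lsum_eq {I J : Type} (f : I -> R) (g : J -> R) l l' : map f l = map g l' -> lsum f l = lsum g l'.
Proof. unfold lsum; intros ->; reflexivity. Qed.

(** Induction on [l]: an entry found in [l'] is cut out of [l'] together with its value, and
    [NoDup l] ensures that no later entry asks for it again. *)
Lemma lsum_support {I : Type} (f : I -> R) (l l' : list I) :
  (forall i, 0 <= f i) -> NoDup l -> (forall i, In i l -> f i = 0 \/ In i l') -> lsum f l <= lsum f l'.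
Proof.
  intros P; revert l'; induction l as [|x l IH]; intros l' D Inc.
  - apply lsum_pos; assumption.
  - inversion D as [|? ? Hx Dl]; subst.
    destruct (Inc x (or_introl eq_refl)) as [E|E].
    + rewrite lsum_cons, E, Rplus_0_l; apply IH; [assumption|]. intros; apply Inc; right; assumption.
    + destruct (in_split x l' E) as (l1 & l2 & ->).
      rewrite lsum_app, !lsum_cons.
      assert (lsum f l <= lsum f (l1 ++ l2)) as Q.
      { apply IH; [assumption|]. intros y Hy.
        destruct (Inc y (or_intror Hy)) as [Z|F]; [left; assumption|right].
        apply in_app_iff in F; apply in_app_iff. destruct F as [F|[->|F]]; [tauto | easy | tauto]. }
      rewrite lsum_app in Q; lra.
Qed.

Lemma lsum_incl {I : Type} (f : I -> R) (l l' : list I) :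
  (forall i, 0 <= f i) -> NoDup l -> incl l l' -> lsum f l <= lsum f l'.
Proof. intros P D Inc; apply lsum_support; auto. Qed.

Lemma list_nat_bound (l : list nat) : exists n, incl l (seq 0 n).
Proof.
  induction l as [|x l [n IH]]; [exists 0%nat; intros ? []|].
  exists (max (S x) n); intros y [<-|Hy]; apply in_seq; [lia|].
  apply IH, in_seq in Hy; lia.
Qed.

Lemma nnsum_le_rsum (f : nat -> R) M :
  (forall i, 0 <= f i) -> (nnsum_le f M <-> forall n, rsum f n <= M).
Proof.
  intro P; split; intro B.
  - intro n; rewrite <- lsum_seq; apply B, seq_NoDup.
  - intros l D; destruct (list_nat_bound l) as [n Hn].
    eapply Rle_trans; [apply lsum_incl; eassumption|]. rewrite lsum_seq; auto.
Qed.

Lemma nnsum_le_pairs (F : nat * nat -> R) M : (forall i, 0 <= F i) ->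
  (forall K, rsum (fun n => rsum (fun k => F (n, k)) K) K <= M) -> nnsum_le F M.
Proof.
  intros P B l D.
  destruct (list_nat_bound (map fst l)) as [a Ha]. destruct (list_nat_bound (map snd l)) as [b Hb].
  set (K := max a b).
  apply Rle_trans with (lsum F (list_prod (seq 0 K) (seq 0 K))).
  - apply lsum_incl; auto. intros [x y] Hxy; apply in_prod_iff; split; apply in_seq.
    + assert (In x (seq 0 a)) as E by (apply Ha; apply (in_map fst _ _ Hxy)).
      apply in_seq in E; lia.
    + assert (In y (seq 0 b)) as E by (apply Hb; apply (in_map snd _ _ Hxy)).
      apply in_seq in E; lia.
  - eapply Rle_trans; [|apply (B K)]. apply Req_le.
    rewrite <- lsum_seq. generalize (seq 0 K) at 1 3 as l1.
    induction l1 as [|x l1 IH]; [reflexivity|].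
    simpl list_prod. rewrite lsum_app, lsum_map, IH, lsum_seq; reflexivity.
Qed.

(** * Real powers *)

Lemma rpow_pos x p : 0 <= rpow x p.
Proof. unfold rpow; destruct (Rle_dec x 0); [lra|]. left; apply exp_pos. Qed.

Lemma rpow_0 p : rpow 0 p = 0.
Proof. unfold rpow; destruct (Rle_dec 0 0); lra. Qed.

Lemma rpow_gt0 x p : 0 < x -> rpow x p = Rpower x p.
Proof. intro L; unfold rpow; destruct (Rle_dec x 0); lra. Qed.

Lemma rpow_lt0 x p : 0 < x -> 0 < rpow x p.
Proof. intro L; rewrite rpow_gt0 by assumption; apply exp_pos. Qed.

Lemma rpow_le x y p : 0 <= p -> x <= y -> rpow x p <= rpow y p.
Proof.
  intros Hp L. destruct (Rle_lt_dec x 0) as [E|E].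
  - unfold rpow at 1; destruct (Rle_dec x 0); [apply rpow_pos | lra].
  - rewrite !rpow_gt0 by lra. apply Rle_Rpower_l; lra.
Qed.

Lemma rpow_mult x y p : 0 <= x -> 0 <= y -> rpow (x * y) p = rpow x p * rpow y p.
Proof.
  intros [Hx|<-]; [|intros; rewrite Rmult_0_l, rpow_0; ring].
  intros [Hy|<-]; [|rewrite Rmult_0_r, rpow_0; ring].
  rewrite !rpow_gt0; auto using Rmult_lt_0_compat. rewrite Rpower_mult_distr; auto.
Qed.

Lemma rpow_sqr x p : 0 <= x -> rpow (x * x) (p / 2) = rpow x p.
Proof.
  intros [Hx|<-]; [|rewrite Rmult_0_l, !rpow_0; ring].
  rewrite !rpow_gt0; auto using Rmult_lt_0_compat. unfold Rpower.
  rewrite ln_mult by assumption; f_equal; field.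
Qed.

(** At [x = 0] both sides vanish for every [q], because [rpow 0] is 0 also at exponents that are
    zero or negative. *)
Lemma rpow_split x q : 0 <= x -> rpow x q = rpow x (q - 1) * x.
Proof.
  intros [Hx|<-]; [|rewrite !rpow_0; ring].
  rewrite !rpow_gt0 by assumption. rewrite <- (Rpower_1 x Hx) at 3.
  rewrite <- Rpower_plus; f_equal; ring.
Qed.

(** Convexity of [exp]: [v] is the mean of [q * v] and 0 with weights [/ q] and [1 - / q]. The
    tangent at [v], evaluated at these two points, comes from [1 + x <= exp x]. *)
Lemma exp_weighted v q : 1 <= q -> exp v <= exp (q * v) / q + (1 - / q).
Proof.
  intro Hq. set (th := / q).
  assert (T : 0 < th <= 1).
  { unfold th; split; [apply Rinv_0_lt_compat; lra|]. rewrite <- Rinv_1; apply Rinv_le_contravar; lra. }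
  assert (Hv : th * (q * v) = v) by (unfold th; field; lra).
  assert (A := exp_ineq1_le (q * v - v)). assert (B := exp_ineq1_le (- v)).
  unfold Rminus in A; rewrite exp_plus in A. assert (P := exp_pos v).
  assert (A' : exp v * (1 + (q * v - v)) <= exp (q * v)).
  { replace (exp (q * v)) with (exp v * (exp (q * v) * exp (- v))); [apply Rmult_le_compat_l; lra|].
    rewrite exp_Ropp; field; lra. }
  assert (B' : exp v * (1 - v) <= 1).
  { replace 1 with (exp v * exp (- v)) at 2; [apply Rmult_le_compat_l; lra|].
    rewrite exp_Ropp; field; lra. }
  unfold Rdiv; fold th.
  assert (A2 := Rmult_le_compat_l th _ _ (Rlt_le _ _ (proj1 T)) A').
  assert (B2 := Rmult_le_compat_l (1 - th) _ _ ltac:(lra) B').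
  replace (th * (exp v * (1 + (q * v - v)))) with (exp v * (th + th * (q * v) - th * v)) in A2 by ring.
  rewrite Hv in A2. nra.
Qed.

(** The graph of x^q lies above its tangent at [t]; for positive arguments this is [exp_weighted] at
    [v = ln a - ln t], scaled by [q * t^q]. *)
Lemma rpow_tangent a t q : 0 <= a -> 0 <= t -> 1 <= q ->
  q * rpow t (q - 1) * a <= rpow a q + (q - 1) * rpow t q.
Proof.
  intros Ha Ht Hq.
  destruct Ha as [Ha|<-].
  2:{ assert (P := rpow_pos t q). rewrite rpow_0; nra. }
  destruct Ht as [Ht|<-].
  2:{ rewrite !rpow_0. assert (P := rpow_pos a q); lra. }
  rewrite (rpow_split t q) by lra. rewrite !rpow_gt0 by assumption.
  assert (E : Rpower a q = exp (q * (ln a - ln t)) * (Rpower t (q - 1) * t)).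
  { unfold Rpower. rewrite <- (exp_ln t Ht) at 3. rewrite <- !exp_plus; f_equal; ring. }
  rewrite E. assert (W := exp_weighted (ln a - ln t) q Hq).
  unfold Rminus in W at 1; rewrite exp_plus, exp_ln, exp_Ropp, exp_ln in W by assumption.
  apply (Rmult_le_compat_l (q * t)) in W; [|nra].
  replace (q * t * (a * / t)) with (q * a) in W by (field; lra).
  replace (q * t * (exp (q * (ln a - ln t)) / q + (1 - / q)))
    with (t * exp (q * (ln a - ln t)) + (q - 1) * t) in W by (field; lra).
  assert (P : 0 < Rpower t (q - 1)) by apply exp_pos.
  apply (Rmult_le_compat_l (Rpower t (q - 1))) in W; [|lra]. lra.
Qed.

(** Adding the tangent inequalities at the midpoint of [a] and [b] cancels their linear parts. *)
Lemma rpow_add_le a b q : 0 <= a -> 0 <= b -> 1 <= q ->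
  2 * rpow (a + b) q <= rpow 2 q * (rpow a q + rpow b q).
Proof.
  intros Ha Hb Hq. set (t := (a + b) / 2). assert (Ht : 0 <= t) by (unfold t; lra).
  replace (a + b) with (2 * t) by (unfold t; field). rewrite rpow_mult by lra.
  assert (A := rpow_tangent a t q Ha Ht Hq). assert (B := rpow_tangent b t q Hb Ht Hq).
  assert (E := rpow_split t q Ht).
  assert (2 * rpow t q <= rpow a q + rpow b q).
  { assert (q * rpow t (q - 1) * a + q * rpow t (q - 1) * b = 2 * q * rpow t q).
    { rewrite E; unfold t; field. }
    lra. }
  assert (P := rpow_pos 2 q). nra.
Qed.

(** Each term is at most the whole sum, so [b k ^ q <= D ^ (q - 1) * b k]. *)
Lemma rsum_rpow_le (b : nat -> R) D q K : (forall k, 0 <= b k) -> 1 <= q ->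
  rsum b K <= D -> rsum (fun k => rpow (b k) q) K <= rpow D q.
Proof.
  intros P Hq Sb.
  assert (HD : 0 <= D) by (eapply Rle_trans; [apply (rsum_pos b K P) | assumption]).
  rewrite (rpow_split D q HD).
  apply Rle_trans with (rpow D (q - 1) * rsum b K).
  - rewrite <- rsum_scal; apply rsum_le; intros i Hi. rewrite rpow_split by auto.
    apply Rmult_le_compat_r; [auto|]. apply rpow_le; [lra|].
    apply Rle_trans with (rsum b (S i)); [|eapply Rle_trans; [apply (rsum_mono b (S i) K); auto | assumption]].
    simpl. assert (Q := rsum_pos b i P); lra.
  - apply Rmult_le_compat_l; [apply rpow_pos | assumption].
Qed.

(** * Orthonormal sequences padded by zero vectors *)

Fixpoint csum (c : nat -> Cpx) (n : nat) : Cpx :=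
  match n with O => C0 | S k => Cadd (csum c k) (c k) end.

Lemma re_csum c n : re (csum c n) = rsum (fun i => re (c i)) n.
Proof. induction n; simpl; congruence. Qed.

Lemma csum_ext (c d : nat -> Cpx) n : (forall i, (i < n)%nat -> c i = d i) -> csum c n = csum d n.
Proof. induction n; simpl; intro E; [reflexivity|]. rewrite IHn, E; auto. Qed.

Lemma csum_zero n : csum (fun _ => C0) n = C0.
Proof. induction n; simpl; [reflexivity|]. rewrite IHn; apply Cpx_ext; simpl; ring. Qed.

Lemma csum_single (c : nat -> Cpx) k n :
  (forall i, i <> k -> c i = C0) -> (k < n)%nat -> csum c n = c k.
Proof.
  intros E; induction n; intro L; [lia|]. simpl.
  destruct (Nat.eq_dec k n) as [->|N].
  - rewrite (csum_ext c (fun _ => C0)), csum_zero by (intros; apply E; lia).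
    apply Cpx_ext; simpl; ring.
  - rewrite IHn by lia. rewrite (E n) by lia. apply Cpx_ext; simpl; ring.
Qed.

Section Padded.
Context {H : HilbertSpace}.
Implicit Types (f u : nat -> H) (x y z : H).

Fixpoint hsum (u : nat -> H) (n : nat) : H :=
  match n with O => hzero | S k => hadd (hsum u k) (u k) end.

Lemma inner_hsum_l u z n : hinner (hsum u n) z = csum (fun i => hinner (u i) z) n.
Proof. induction n; simpl; [apply inner_zero_l|]. rewrite hinner_add_l, IHn; reflexivity. Qed.

Lemma inner_hsum_r u z n : hinner z (hsum u n) = csum (fun i => hinner z (u i)) n.
Proof. induction n; simpl; [apply inner_zero_r|]. rewrite inner_add_r, IHn; reflexivity. Qed.

(* Zero terms let a single index type, [nat], serve for bases of any countable size. *)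
Definition ons f : Prop :=
  (forall n, f n = hzero \/ hinner (f n) (f n) = C1) /\
  (forall n m, n <> m -> hinner (f n) (f m) = C0).

Definition complete_seq f : Prop := forall x, (forall n, hinner x (f n) = C0) -> x = hzero.

Definition lincomb (c : nat -> Cpx) f : nat -> H := hsum (fun i => hscal (c i) (f i)).

Lemma ons_nsq_le1 f n : ons f -> nsq (f n) <= 1.
Proof.
  intros [U _]; destruct (U n) as [E|E]; unfold nsq; rewrite E;
    [rewrite inner_zero_l|]; simpl; lra.
Qed.

(** The factor [nsq (f n)] is 0 or 1, and where it is 0 the coefficient is already 0; this is how
    the padding disappears from Fourier formulas. *)
Lemma ons_coef f x n : ons f -> Cmul (hinner x (f n)) (RtoC (nsq (f n))) = hinner x (f n).
Proof.
  intros [U _]; destruct (U n) as [E|E].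
  - rewrite E, inner_zero_r; apply Cpx_ext; simpl; ring.
  - unfold nsq; rewrite E; apply Cpx_ext; simpl; ring.
Qed.

Lemma ons_coef_n2 f x n : ons f -> Cn2 (hinner x (f n)) * nsq (f n) = Cn2 (hinner x (f n)).
Proof.
  intro O; destruct O as [U V]; destruct (U n) as [E|E].
  - rewrite E, inner_zero_r; unfold Cn2; simpl; ring.
  - unfold nsq; rewrite E; simpl; ring.
Qed.

Lemma inner_lincomb c f k n : ons f -> (k < n)%nat ->
  hinner (lincomb c f n) (f k) = Cmul (c k) (RtoC (nsq (f k))).
Proof.
  intros [_ V] L. unfold lincomb; rewrite inner_hsum_l, (csum_single _ k n); auto.
  - rewrite hinner_scal_l, inner_self; reflexivity.
  - intros i N; rewrite hinner_scal_l, V by assumption; apply Cpx_ext; simpl; ring.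
Qed.

Lemma inner_lincomb_out c f k n : ons f -> (n <= k)%nat -> hinner (lincomb c f n) (f k) = C0.
Proof.
  intros [_ V] L. unfold lincomb; rewrite inner_hsum_l, <- (csum_zero n); apply csum_ext.
  intros i Hi; rewrite hinner_scal_l, V by lia; apply Cpx_ext; simpl; ring.
Qed.

(** Pythagoras for a block of terms; it turns convergence of the numerical series into the Cauchy
    property of the vector series. *)
Lemma nsq_lincomb_diff c f m k : ons f ->
  nsq (hsub (lincomb c f (m + k)) (lincomb c f m)) =
  rsum (fun i => Cn2 (c i) * nsq (f i)) (m + k) - rsum (fun i => Cn2 (c i) * nsq (f i)) m.
Proof.
  intro O; induction k.
  - rewrite Nat.add_0_r, nsq_sub; unfold nsq; ring.
  - rewrite Nat.add_succ_r; simpl.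
    replace (hsub (lincomb c f (S (m + k))) (lincomb c f m))
      with (hadd (hsub (lincomb c f (m + k)) (lincomb c f m)) (hscal (c (m + k)%nat) (f (m + k)%nat))).
    2:{ change (lincomb c f (S (m + k))) with
          (hadd (lincomb c f (m + k)) (hscal (c (m + k)%nat) (f (m + k)%nat))). hext; ring. }
    rewrite nsq_add, IHk, nsq_scal.
    replace (re (hinner _ _)) with 0; [ring|].
    unfold hsub; rewrite inner_scal_r, hinner_add_l, inner_opp_l.
    rewrite !inner_lincomb_out by (assumption || lia); simpl; ring.
Qed.

Lemma nsq_lincomb c f n : ons f -> nsq (lincomb c f n) = rsum (fun i => Cn2 (c i) * nsq (f i)) n.
Proof.
  intro O. assert (E := nsq_lincomb_diff c f 0 n O). simpl in E. rewrite Rminus_0_r in E.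
  rewrite <- E; f_equal. change (lincomb c f 0) with (@hzero H). hext; ring.
Qed.

Lemma bessel f x n : ons f -> rsum (fun i => Cn2 (hinner x (f i))) n <= nsq x.
Proof.
  intro O. set (c := fun i => hinner x (f i)).
  assert (P := nsq_pos (hsub x (lincomb c f n))).
  rewrite nsq_sub, nsq_lincomb in P by assumption.
  assert (E1 : rsum (fun i => Cn2 (c i) * nsq (f i)) n = rsum (fun i => Cn2 (c i)) n)
    by (apply rsum_ext; intros; apply ons_coef_n2; assumption).
  assert (E2 : re (hinner x (lincomb c f n)) = rsum (fun i => Cn2 (c i)) n).
  { unfold lincomb; rewrite inner_hsum_r, re_csum; apply rsum_ext; intros i _.
    rewrite inner_scal_r; fold (c i); unfold Cn2; simpl; ring. }
  rewrite E1, E2 in P; unfold c in *; lra.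
Qed.

(** Riesz-Fischer. The coefficients of the limit are read off from partial sums that are constant
    once [n > k]. *)
Lemma ons_series c f K : ons f ->
  (forall n, rsum (fun i => Cn2 (c i) * nsq (f i)) n <= K) ->
  exists l, hcv (lincomb c f) l /\ forall k, hinner l (f k) = Cmul (c k) (RtoC (nsq (f k))).
Proof.
  intros O B. set (t := fun i => Cn2 (c i) * nsq (f i)).
  assert (Pt : forall i, 0 <= t i) by (intro; apply Rmult_le_pos; [apply Cn2_pos | apply nsq_pos]).
  destruct (hcauchy_cv (lincomb c f)) as [l Hl].
  { destruct (infinite_sum_of_bounded t K Pt B) as [L HL]; apply infinite_sum_rsum in HL.
    intros eps He. destruct (HL (eps * eps / 2)) as [N HN]; [nra|].
    exists N.
    assert (W : forall m k, (m >= N)%nat ->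
      hnorm (hsub (lincomb c f (m + k)) (lincomb c f m)) < eps).
    { intros m k Hm. assert (P := norm_pos (hsub (lincomb c f (m + k)) (lincomb c f m))).
      assert (E := norm_sqr (hsub (lincomb c f (m + k)) (lincomb c f m))).
      rewrite nsq_lincomb_diff in E by assumption. fold t in E.
      assert (A1 := HN m Hm); assert (A2 := HN (m + k)%nat ltac:(lia)).
      unfold Rdist in A1, A2; apply Rabs_def2 in A1; apply Rabs_def2 in A2. nra. }
    intros m n Hm Hn. destruct (Nat.le_gt_cases m n) as [Q|Q].
    - rewrite norm_sub_sym. replace n with (m + (n - m))%nat by lia. apply W; assumption.
    - replace m with (n + (m - n))%nat by lia. apply W; assumption. }
  exists l; split; [assumption|]. intro k.
  destruct (hcv_inner _ _ (f k) Hl) as [Cr Ci].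
  assert (G : forall (pr : Cpx -> R), Un_cv (fun n => pr (hinner (lincomb c f n) (f k)))
     (pr (Cmul (c k) (RtoC (nsq (f k)))))).
  { intros pr eps He; exists (S k); intros n Hn. rewrite inner_lincomb by (assumption || lia).
    unfold Rdist; rewrite Rminus_diag, Rabs_R0; lra. }
  apply Cpx_ext; [apply (UL_sequence _ _ _ Cr (G re)) | apply (UL_sequence _ _ _ Ci (G im))].
Qed.

Lemma complete_ext f x y : complete_seq f -> (forall n, hinner x (f n) = hinner y (f n)) -> x = y.
Proof.
  intros Cf E; apply sub_eq0, Cf; intro n. unfold hsub; rewrite hinner_add_l, inner_opp_l, E.
  apply Cpx_ext; simpl; ring.
Qed.

(** Bessel makes the series converge; its limit has the same coefficients as [x], and completeness
    identifies the two. *)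
Lemma fourier_cv f x : ons f -> complete_seq f -> hcv (lincomb (fun i => hinner x (f i)) f) x.
Proof.
  intros O Cf.
  destruct (ons_series (fun i => hinner x (f i)) f (nsq x) O) as (l & Hl & E).
  { intro n. eapply Rle_trans; [|apply (bessel f x n O)]. apply Req_le, rsum_ext.
    intros; apply ons_coef_n2; assumption. }
  assert (El : l = x).
  { apply (complete_ext f); [assumption|]. intro n; rewrite E; apply ons_coef; assumption. }
  rewrite El in Hl; assumption.
Qed.

Lemma parseval f x : ons f -> complete_seq f ->
  Un_cv (rsum (fun i => Cn2 (hinner x (f i)))) (nsq x).
Proof.
  intros O Cf. assert (C := hcv_nsq _ _ (fourier_cv f x O Cf)).
  revert C; apply Un_cv_ext; intro n. rewrite nsq_lincomb by assumption.
  apply rsum_ext; intros; apply ons_coef_n2; assumption.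
Qed.

End Padded.

(** * Bounded and compact operators *)

Section Operators.
Context {H : HilbertSpace}.
Implicit Types (T S B L Q : H -> H) (u : nat -> H) (x y z : H).

Definition bounded_op T : Prop := exists K, 0 <= K /\ forall x, hnorm (T x) <= K * hnorm x.

Definition symmetric_op B : Prop := forall x y, hinner (B x) y = hinner x (B y).

Lemma linear_sub T x y : linear_op T -> T (hsub x y) = hsub (T x) (T y).
Proof.
  intros [A M]. unfold hsub.
  replace (hopp y) with (hscal (mkC (-1) 0) y) by (hext; ring).
  rewrite A, M; hext; ring.
Qed.

Lemma linear_zero T : linear_op T -> T hzero = hzero.
Proof.
  intros [A M]. replace (@hzero H) with (hscal C0 (@hzero H)) at 1 by (hext; ring).
  rewrite M; hext; ring.
Qed.

Lemma hcv_bounded T u l : linear_op T -> bounded_op T -> hcv u l -> hcv (fun n => T (u n)) (T l).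
Proof.
  intros Lin (K & HK & B) C. apply (hcv_squeeze u _ l _ K); auto.
  intro n; rewrite <- linear_sub by assumption; apply B.
Qed.

Lemma subseq_ge (phi : nat -> nat) : (forall n, (phi n < phi (S n))%nat) -> forall n, (n <= phi n)%nat.
Proof. intros P n; induction n; [lia | specialize (P n); lia]. Qed.

Lemma subseq_comp (phi psi : nat -> nat) : (forall n, (phi n < phi (S n))%nat) ->
  (forall n, (psi n < psi (S n))%nat) -> forall n, (phi (psi n) < phi (psi (S n)))%nat.
Proof.
  intros P Q n. assert (M : forall a k, (phi a < phi (a + S k))%nat).
  { intros a k; induction k; [rewrite Nat.add_1_r; apply P|].
    specialize (P (a + S k)%nat). rewrite Nat.add_succ_r; lia. }
  specialize (Q n). replace (psi (S n)) with (psi n + S (psi (S n) - S (psi n)))%nat by lia. apply M.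
Qed.

Lemma compact_subseq T u b : compact_op T -> (forall n, hnorm (u n) <= b) ->
  exists (phi : nat -> nat) l, (forall n, (phi n < phi (S n))%nat) /\ hcv (fun n => T (u (phi n))) l.
Proof. intros [_ C] Hb; exact (C u (ex_intro _ b Hb)). Qed.

Lemma compact_bounded T : compact_op T -> bounded_op T.
Proof.
  intro CT; assert (Lin := proj1 CT). apply NNPP; intro N.
  assert (E : forall n : nat, exists x, hnorm x <= 1 /\ INR n < hnorm (T x)).
  { intro n. apply NNPP; intro M; apply N. exists (INR n); split; [apply pos_INR|].
    intro x. destruct (classic (x = hzero)) as [->|Nx].
    - rewrite linear_zero by assumption. unfold hnorm; rewrite inner_zero_l; simpl.
      rewrite sqrt_0; lra.
    - destruct (normalize x Nx) as (r & Hr & E & U).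
      apply Rnot_lt_le; intro Lt; apply M; exists (hscal (RtoC r) x). split.
      + unfold hnorm; rewrite U; simpl; rewrite sqrt_1; lra.
      + rewrite (proj2 Lin), norm_scal.
        replace (Cmod (RtoC r)) with r.
        2:{ unfold Cmod; simpl. rewrite Rmult_0_r, Rplus_0_r, sqrt_square; lra. }
        apply (Rmult_lt_compat_l r) in Lt; [|assumption].
        replace (r * (INR n * hnorm x)) with (INR n * (r * hnorm x)) in Lt by ring.
        rewrite E in Lt; lra. }
  destruct (choice _ E) as [u Hu].
  destruct (compact_subseq T u 1 CT) as (phi & l & Hp & C); [intro; apply Hu|].
  destruct (C 1) as [k Hk]; [lra|].
  destruct (INR_unbounded (1 + hnorm l)) as [m Hm].
  set (n := max k m). specialize (Hk n ltac:(lia)).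
  assert (A := proj2 (Hu (phi n))).
  assert (Le : INR m <= INR (phi n)) by (apply le_INR; assert (G := subseq_ge phi Hp n); lia).
  assert (Tr := norm_triangle (hsub (T (u (phi n))) l) l).
  replace (hadd (hsub (T (u (phi n))) l) l) with (T (u (phi n))) in Tr by (hext; ring). lra.
Qed.

Lemma compact_comp_l L T : linear_op L -> bounded_op L -> compact_op T -> compact_op (fun x => L (T x)).
Proof.
  intros LL BL CT; split.
  - destruct LL as [A M], CT as [[A' M'] _]; split; intros; rewrite ?A', ?M'; auto.
  - intros u [b Hb]. destruct (compact_subseq T u b CT Hb) as (phi & l & Hp & C).
    exists phi, (L l); split; [assumption|]. apply hcv_bounded; assumption.
Qed.

Lemma compact_comp_r L T : linear_op L -> bounded_op L -> compact_op T -> compact_op (fun x => T (L x)).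
Proof.
  intros LL (K & HK & BL) CT; split.
  - destruct LL as [A M], CT as [[A' M'] _]; split; intros; rewrite ?A, ?M; auto.
  - intros u [b Hb]. apply (compact_subseq T (fun n => L (u n)) (K * b) CT).
    intro n; eapply Rle_trans; [apply BL|]. apply Rmult_le_compat_l; auto.
Qed.

Lemma compact_add T S : compact_op T -> compact_op S -> compact_op (fun x => hadd (T x) (S x)).
Proof.
  intros CT CS; split.
  - destruct CT as [[A M] _], CS as [[A' M'] _]; split; intros; rewrite ?A, ?A', ?M, ?M'; hext; ring.
  - intros u [b Hb]. destruct (compact_subseq T u b CT Hb) as (phi & l & Hp & C).
    destruct (compact_subseq S (fun n => u (phi n)) b CS (fun n => Hb (phi n))) as (psi & m & Hq & D).
    exists (fun n => phi (psi n)), (hadd l m); split; [apply subseq_comp; assumption|].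
    apply hcv_add; [|assumption]. apply (hcv_subseq _ _ psi Hq C).
Qed.

Lemma linear_scal (a : Cpx) : linear_op (fun x : H => hscal a x).
Proof. split; intros; hext; ring. Qed.

Lemma compact_scal a T : compact_op T -> compact_op (fun x => hscal a (T x)).
Proof.
  intro CT; apply (compact_comp_l (hscal a) T); [apply linear_scal | | assumption].
  exists (Cmod a); split; [apply sqrt_pos|]. intro x; rewrite norm_scal; lra.
Qed.

Lemma compact_zero : compact_op (fun _ : H => hzero).
Proof.
  split; [split; intros; hext; ring|]. intros u _. exists (fun n => n), hzero; split; [lia|].
  intros eps He; exists 0%nat; intros n _. unfold hnorm, hsub; autorewrite with inner; simpl.
  replace (_ + _) with 0 by ring; rewrite sqrt_0; lra.
Qed.

(** Along a subsequence where [Q u] is Cauchy, the domination applied to differences makes [S u]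
    Cauchy. Used with [Q = T T^*] for the adjoint and with [Q = T^* T] for its square root. *)
Lemma compact_dominated S Q : linear_op S -> compact_op Q ->
  (forall x, nsq (S x) <= hnorm (Q x) * hnorm x) -> compact_op S.
Proof.
  intros LS CQ D; split; [assumption|]. intros u [b Hb].
  destruct (compact_subseq Q u b CQ Hb) as (phi & l & Hp & C).
  destruct (hcauchy_cv (fun n => S (u (phi n)))) as [m Hm]; [|exists phi, m; split; assumption].
  assert (b0 : 0 <= b) by (apply Rle_trans with (hnorm (u 0%nat)); [apply norm_pos | apply Hb]).
  intros eps He. destruct (hcv_cauchy _ _ C (eps * eps / (2 * b + 1))) as [N HN].
  { apply Rdiv_lt_0_compat; nra. }
  exists N; intros i j Hi Hj. specialize (HN i j Hi Hj).
  rewrite <- linear_sub by assumption. rewrite <- linear_sub in HN by apply CQ.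
  set (v := hsub (u (phi i)) (u (phi j))) in *.
  assert (Hv : hnorm v <= 2 * b).
  { unfold v. assert (Tr := norm_sub_triangle (u (phi i)) hzero (u (phi j))).
    replace (hsub (u (phi i)) hzero) with (u (phi i)) in Tr by (hext; ring).
    rewrite (norm_sub_sym hzero) in Tr.
    replace (hsub (u (phi j)) hzero) with (u (phi j)) in Tr by (hext; ring).
    assert (B1 := Hb (phi i)); assert (B2 := Hb (phi j)); lra. }
  specialize (D v). rewrite <- norm_sqr in D.
  assert (P1 := norm_pos (S v)); assert (P2 := norm_pos (Q v)); assert (P3 := norm_pos v).
  apply (Rmult_lt_compat_r (2 * b + 1)) in HN; [|lra].
  replace (eps * eps / (2 * b + 1) * (2 * b + 1)) with (eps * eps) in HN by (field; lra).
  nra.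
Qed.

(** * Eigenvectors of compact symmetric operators *)

(** Allows the search for an eigenvector inside an orthogonal complement without making that
    complement a [HilbertSpace] of its own. *)
Record closed_invariant B (V : H -> Prop) : Prop := {
  ci_add : forall x y, V x -> V y -> V (hadd x y);
  ci_scal : forall a x, V x -> V (hscal a x);
  ci_op : forall x, V x -> V (B x);
  ci_lim : forall u l, (forall n, V (u n)) -> hcv u l -> V l }.

(* A maximizing sequence for [nsq (B x)] on the unit sphere of [V] is an approximate
   eigenvector sequence of [B^2] for the supremum [m], hence converges up to a subsequence
   to some [x] with [B (B x) = m x]; then [B x + sqrt m x] or [x] is an eigenvector of [B]. *)
Lemma exists_eigenvector B V : compact_op B -> symmetric_op B -> closed_invariant B V ->
  (exists x, V x /\ x <> hzero) ->
  exists x mu, V x /\ hinner x x = C1 /\ B x = hscal (RtoC mu) x.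
Proof.
  intros CB Sy CV (x0 & Vx0 & Nx0).
  assert (Lin := proj1 CB). assert (Bd := compact_bounded B CB).
  set (E := fun r => exists x, V x /\ hinner x x = C1 /\ r = nsq (B x)).
  destruct (normalize x0 Nx0) as (r0 & _ & _ & U0). set (x1 := hscal (RtoC r0) x0) in *.
  assert (Vx1 : V x1) by (apply (ci_scal _ _ CV); assumption).
  destruct (completeness E) as [m [Hub Hlub]].
  { destruct Bd as (K & HK & Bd). exists (K * K). intros r (x & _ & U & ->).
    rewrite <- norm_sqr. specialize (Bd x). assert (P := norm_pos (B x)).
    replace (hnorm x) with 1 in Bd by (unfold hnorm; rewrite U; simpl; rewrite sqrt_1; reflexivity).
    nra. }
  { exists (nsq (B x1)), x1; auto. }
  assert (m0 : 0 <= m).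
  { eapply Rle_trans; [apply (nsq_pos (B x1))|]. apply Hub; exists x1; auto. }
  assert (Hm : forall v, V v -> nsq (B v) <= m * nsq v).
  { intros v Vv. destruct (classic (v = hzero)) as [->|Nv].
    - rewrite linear_zero, nsq_zero by assumption; lra.
    - destruct (normalize v Nv) as (r & Hr & Er & Ur).
      assert (nsq (B (hscal (RtoC r) v)) <= m) as Q.
      { apply Hub; exists (hscal (RtoC r) v); split; [apply (ci_scal _ _ CV); assumption | auto]. }
      rewrite (proj2 Lin), nsq_scal in Q. unfold Cn2 in Q; simpl in Q.
      rewrite <- (norm_sqr v). assert (Pn := norm_pos v).
      apply (Rmult_le_compat_r (hnorm v * hnorm v)) in Q; [|nra].
      replace ((r * r + 0 * 0) * nsq (B v) * (hnorm v * hnorm v)) with (nsq (B v) * ((r * hnorm v) * (r * hnorm v))) in Q by ring.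
      rewrite Er in Q; lra. }
  destruct m0 as [m0|m0].
  (* If the supremum is 0, then [B] vanishes on [V] and any unit vector of [V] has eigenvalue 0. *)
  2:{ exists x1, 0; repeat split; auto. specialize (Hm x1 Vx1). rewrite <- m0, Rmult_0_l in Hm.
      rewrite (nsq_eq0 (B x1)); [hext; ring|]. apply Rle_antisym; [assumption | apply nsq_pos]. }
  assert (Seq : forall n : nat, exists x, V x /\ hinner x x = C1 /\ m - / (INR n + 1) < nsq (B x)).
  { intro n. apply NNPP; intro N.
    assert (Pn : 0 < / (INR n + 1)) by (apply Rinv_0_lt_compat; assert (P := pos_INR n); lra).
    assert (m <= m - / (INR n + 1)); [|lra].
    apply Hlub. intros r (x & Vx & Ux & ->). apply Rnot_lt_le; intro; apply N; exists x; auto. }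
  destruct (choice _ Seq) as [u Hu].
  assert (Nu : forall n, nsq (u n) = 1) by (intro n; unfold nsq; rewrite (proj1 (proj2 (Hu n))); reflexivity).
  destruct (compact_subseq B u 1 CB) as (phi & y & Hp & Cy).
  { intro n; apply norm_le_of_nsq; [lra|]. rewrite Nu; lra. }
  assert (CBB : hcv (fun n => hsub (B (B (u n))) (hscal (RtoC m) (u n))) hzero).
  { intros eps He.
    destruct (INR_unbounded (m / (eps * eps))) as [N HN].
    exists N; intros n Hn. destruct (Hu n) as (Vn & Un & Ln).
    replace (hsub (hsub (B (B (u n))) (hscal (RtoC m) (u n))) hzero)
      with (hsub (B (B (u n))) (hscal (RtoC m) (u n))) by (hext; ring).
    set (w := hsub _ _).
    (* The square expands to [nsq (B (B u)) - 2 m nsq (B u) + m^2], and [Hm] at [B u] bounds its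
       first term by [m nsq (B u)]. *)
    assert (W : nsq w <= m * (m - nsq (B (u n)))).
    { unfold w; rewrite nsq_sub, nsq_scal, Nu.
      replace (re (hinner (B (B (u n))) (hscal (RtoC m) (u n)))) with (m * nsq (B (u n))).
      2:{ rewrite inner_scal_r, Sy; unfold nsq; simpl; ring. }
      unfold Cn2; simpl. assert (Q := Hm (B (u n)) (ci_op _ _ CV _ Vn)). lra. }
    assert (Pn := pos_INR n). assert (INR N <= INR n) by (apply le_INR; lia).
    assert (Lt : m * / (INR n + 1) < eps * eps).
    { apply (Rmult_lt_reg_r (INR n + 1)); [lra|]. rewrite Rmult_assoc, Rinv_l by lra.
      assert (He2 : 0 < eps * eps) by nra.
      assert (m / (eps * eps) < INR n + 1) as Q by lra.
      apply (Rmult_lt_compat_l (eps * eps)) in Q; [|assumption].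
      replace (eps * eps * (m / (eps * eps))) with m in Q by (field; lra). lra. }
    assert (Pw := norm_pos w). rewrite <- norm_sqr in W. nra. }
  (* Along [phi], [B (B u)] converges and [B (B u) - m u] tends to zero; dividing by [m > 0] makes
     [u] itself converge. *)
  assert (Cx : hcv (fun n => u (phi n)) (hscal (RtoC (/ m)) (B y))).
  { assert (C1' := hcv_subseq _ _ phi Hp CBB). cbv beta in C1'.
    assert (C2' := hcv_bounded B _ _ Lin Bd Cy).
    assert (C3 := hcv_scal (RtoC (/ m)) _ _ (hcv_add _ _ _ _ C2' (hcv_scal (RtoC (-1)) _ _ C1'))).
    replace (hadd (B y) (hscal (RtoC (-1)) hzero)) with (B y) in C3 by (hext; ring).
    revert C3; apply hcv_ext; intro n. hext; field; lra. }
  set (x := hscal (RtoC (/ m)) (B y)) in *.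
  assert (Vx : V x) by (apply (ci_lim _ _ CV (fun n => u (phi n))); [intro; apply Hu | assumption]).
  assert (Ux : nsq x = 1).
  { apply (UL_sequence (fun n => nsq (u (phi n)))); [apply hcv_nsq; assumption|].
    apply (Un_cv_ext (fun _ => 1)); [intro; symmetry; apply Nu | apply Un_cv_const]. }
  assert (Ey : y = B x) by (apply (hcv_unique _ _ _ Cy), hcv_bounded; assumption).
  assert (EBB : B (B x) = hscal (RtoC m) x).
  { rewrite <- Ey. unfold x. hext; field; lra. }
  set (r := sqrt m). assert (Er : r * r = m) by (apply sqrt_sqrt; lra).
  destruct (classic (hadd (B x) (hscal (RtoC r) x) = hzero)) as [Z|Z].
  - exists x, (- r); split; [assumption|]. split; [rewrite inner_self, Ux; reflexivity|].
    replace (B x) with (hadd (hadd (B x) (hscal (RtoC r) x)) (hscal (RtoC (- r)) x)) by (hext; ring).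
    rewrite Z; hext; ring.
  - set (z := hadd (B x) (hscal (RtoC r) x)) in *.
    assert (Bz : B z = hscal (RtoC r) z).
    { unfold z; rewrite (proj1 Lin), (proj2 Lin), EBB, <- Er. hext; ring. }
    destruct (normalize z Z) as (t & _ & _ & Ut).
    exists (hscal (RtoC t) z), r. split; [|split; [assumption|]].
    + apply (ci_scal _ _ CV), (ci_add _ _ CV); [apply (ci_op _ _ CV) | apply (ci_scal _ _ CV)]; assumption.
    + rewrite (proj2 Lin), Bz; hext; ring.
Qed.

(** For a unit vector the eigenvalue is [<B x, x>], so none has to be carried along; for linear [B]
    the zero vectors of a padded basis qualify too. *)
Definition eigenvec B x : Prop := B x = hscal (RtoC (re (hinner (B x) x))) x.

Lemma eigenvec_intro B x mu : hinner x x = C1 -> B x = hscal (RtoC mu) x -> eigenvec B x.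
Proof.
  intros U E. unfold eigenvec. replace (re (hinner (B x) x)) with mu; [assumption|].
  rewrite E, hinner_scal_l, U; simpl; ring.
Qed.

(** Zorn's lemma gives a maximal orthonormal set of eigenvectors. Its orthogonal complement is
    closed and invariant, so a nonzero vector there would yield one more eigenvector. *)
Lemma eigenbasis_exists B : compact_op B -> symmetric_op B ->
  exists (I : Type) (e : I -> H), orthonormal_basis e /\ forall i, eigenvec B (e i).
Proof.
  intros CB Sy.
  set (P := fun S : H -> Prop => (forall x, S x -> hinner x x = C1 /\ eigenvec B x) /\
             (forall x y, S x -> S y -> x <> y -> hinner x y = C0)).
  destruct (@classical_sets.Zorn_bigcup H P) as (A & [PA1 PA2] & Max).
  { intros F FP Tot; split.
    - intros x [X FX Xx]; exact (proj1 (FP X FX) x Xx).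
    - intros x y [X FX Xx] [Y FY Yy] N.
      destruct (Tot X Y FX FY) as [L|L].
      + apply (proj2 (FP Y FY)); auto.
      + apply (proj2 (FP X FX)); auto. }
  exists {x : H | A x}, (@proj1_sig H A). repeat split.
  - intros [x Ax]; apply PA1; assumption.
  - intros [x Ax] [y Ay] N; apply PA2; auto. simpl; intro E; apply N; subst y; f_equal.
    apply proof_irrelevance.
  - set (V := fun x => forall y, A y -> hinner x y = C0).
    assert (CV : closed_invariant B V).
    { split.
      - intros x y Vx Vy z Az; rewrite hinner_add_l, Vx, Vy by assumption; apply Cpx_ext; simpl; ring.
      - intros a x Vx z Az; rewrite hinner_scal_l, Vx by assumption; apply Cpx_ext; simpl; ring.
      - intros x Vx z Az. destruct (PA1 z Az) as [_ E]. rewrite Sy, E, inner_scal_r, Vx by assumption.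
        apply Cpx_ext; simpl; ring.
      - intros u l Vu C z Az. assert (Z : hcv (fun _ : nat => @hzero H) hzero).
        { intros eps He; exists 0%nat; intros. unfold hnorm, hsub; autorewrite with inner; simpl.
          replace (_ + _) with 0 by ring; rewrite sqrt_0; lra. }
        rewrite (inner_limit_eq u (fun _ => hzero) l hzero z z C Z); [apply inner_zero_r|].
        intro n; rewrite Vu, inner_zero_r by assumption; reflexivity. }
    intros x Hx. apply NNPP; intro N.
    destruct (exists_eigenvector B V CB Sy CV) as (v & mu & Vv & Uv & Ev).
    { exists x; split; [|assumption]. intros y Ay; exact (Hx (exist _ y Ay)). }
    assert (NAv : ~ A v).
    { intro Av; assert (E := Vv v Av). rewrite Uv in E. apply (f_equal re) in E; simpl in E; lra. }
    apply (Max (fun w => A w \/ w = v)).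
    + split; [intros w Aw; left; assumption|]. intro L; apply NAv, (L v); right; reflexivity.
    + split.
      * intros w [Aw| ->]; [apply PA1; assumption|]. split; [assumption|].
        apply (eigenvec_intro B v mu); assumption.
      * intros w w' [Aw| ->] [Aw'| ->] Ne; [apply PA2; assumption | | apply Vv; assumption | easy].
        rewrite hinner_conj, Vv by assumption; apply Cpx_ext; simpl; ring.
  - intros [x Ax]; apply PA1; assumption.
Qed.

(** Distinct basis vectors are at squared distance 2, hence cannot both lie within 1/2 of the same
    point of the dense sequence; the index of a nearby point is therefore injective. *)
Lemma padded_of_basis {I : Type} (e : I -> H) : separable H -> orthonormal_basis e ->
  exists (g : I -> nat) (f : nat -> H),
    (forall i j, g i = g j -> i = j) /\ (forall i, f (g i) = e i) /\
    (forall n, (exists i, g i = n) \/ f n = hzero) /\ ons f /\ complete_seq f.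
Proof.
  intros [d Hd] (U & O & Cp).
  destruct (choice (fun i n => hnorm (hsub (e i) (d n)) < / 2)) as [g Hg].
  { intro i; apply Hd; lra. }
  assert (Inj : forall i j, g i = g j -> i = j).
  { intros i j E. apply NNPP; intro N.
    assert (A := Hg i); assert (B := Hg j). rewrite <- E in B. rewrite norm_sub_sym in B.
    assert (Tr := norm_sub_triangle (e i) (d (g i)) (e j)).
    assert (S := norm_sqr (hsub (e i) (e j))). rewrite nsq_sub in S.
    unfold nsq in S; rewrite !U, O in S by assumption; simpl in S.
    assert (P := norm_pos (hsub (e i) (e j))). nra. }
  set (f := fun n => match excluded_middle_informative (exists i, g i = n) with
    | left h => e (proj1_sig (constructive_indefinite_description _ h)) | right _ => hzero end).
  assert (Ef : forall i, f (g i) = e i).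
  { intro i; unfold f. destruct (excluded_middle_informative _) as [h|h].
    - f_equal; apply Inj, (proj2_sig (constructive_indefinite_description _ h)).
    - exfalso; apply h; exists i; reflexivity. }
  assert (Zf : forall n, (exists i, g i = n) \/ f n = hzero).
  { intro n; destruct (classic (exists i, g i = n)) as [h|h]; [left; assumption|right].
    unfold f; destruct (excluded_middle_informative _); easy. }
  exists g, f; repeat split; auto.
  - intro n; destruct (Zf n) as [[i <-]|E]; [right; rewrite Ef; apply U | left; assumption].
  - intros n m N. destruct (Zf n) as [[i <-]|E]; [|rewrite E; apply inner_zero_l].
    destruct (Zf m) as [[j <-]|E]; [|rewrite E; apply inner_zero_r].
    rewrite !Ef; apply O; intros ->; easy.
  - intros x Hx; apply Cp; intro i; rewrite <- Ef; apply Hx.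
Qed.

End Operators.

(** * Adjoints *)

Section Adjoint.
Context {H : HilbertSpace}.
Implicit Types (T B A : H -> H) (f u : nat -> H) (x y z : H).

Definition adjoint T Tad : Prop := forall x y, hinner (T x) y = hinner x (Tad y).

Lemma linear_lincomb T c f n : linear_op T -> T (lincomb c f n) = lincomb c (fun i => T (f i)) n.
Proof.
  intro L; unfold lincomb; induction n; simpl; [apply linear_zero; assumption|].
  rewrite (proj1 L), (proj2 L), IHn; reflexivity.
Qed.

(** An eigenbasis of the zero operator is just an orthonormal basis. *)
Lemma padded_basis_exists : separable H -> exists f : nat -> H, ons f /\ complete_seq f.
Proof.
  intro Sep. destruct (eigenbasis_exists (fun _ : H => hzero) compact_zero) as (I & e & O & _).
  { intros x y; rewrite inner_zero_l, inner_zero_r; reflexivity. }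
  destruct (padded_of_basis e Sep O) as (g & f & _ & _ & _ & F); exists f; assumption.
Qed.

(* [Tad y] is defined by its Fourier series, with coefficients [hinner y (T (f n))]. *)
Lemma adjoint_exists T : separable H -> compact_op T -> exists Tad, adjoint T Tad.
Proof.
  intros Sep CT. assert (Lin := proj1 CT). destruct (compact_bounded T CT) as (K & HK & Bd).
  destruct (padded_basis_exists Sep) as (f & O & Cf).
  assert (E : forall y, exists w, forall x, hinner (T x) y = hinner x w).
  { intro y. set (c := fun n => hinner y (T (f n))).
    assert (Sc : forall i, Cn2 (c i) * nsq (f i) = Cn2 (c i)).
    { intro i; destruct (proj1 O i) as [Z|Z].
      - unfold c; rewrite Z, linear_zero, inner_zero_r by assumption; unfold Cn2; simpl; ring.
      - unfold nsq; rewrite Z; simpl; ring. }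
    destruct (ons_series c f ((K * hnorm y) * (K * hnorm y)) O) as (w & Hw & _).
    (* Testing on the partial sum [v] itself gives [nsq v = re <T v, y> <= K |v| |y|], hence
       [|v| <= K |y|] for every [n]. *)
    { intro n. set (v := lincomb c f n).
      assert (E1 : nsq v = rsum (fun i => Cn2 (c i) * nsq (f i)) n) by (apply nsq_lincomb; assumption).
      assert (E2 : re (hinner (T v) y) = nsq v).
      { unfold v at 1; rewrite linear_lincomb by assumption. unfold lincomb.
        rewrite inner_hsum_l, re_csum, E1; apply rsum_ext; intros i _.
        rewrite Sc, hinner_scal_l, (hinner_conj H y (T (f i))); fold (c i). unfold Cn2; simpl; ring. }
      assert (L1 := cauchy_schwarz_norm (T v) y). assert (L2 := Cmod_re (hinner (T v) y)).
      assert (L3 := Rle_abs (re (hinner (T v) y))). specialize (Bd v).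
      rewrite <- E1. rewrite E2 in *. rewrite <- norm_sqr in *.
      assert (P1 := norm_pos v); assert (P2 := norm_pos y).
      assert (Q : hnorm v * hnorm v <= (K * hnorm y) * hnorm v) by nra.
      assert (Q2 : hnorm v <= K * hnorm y).
      { destruct P1 as [P1|P1]; [apply (Rmult_le_reg_r (hnorm v)); assumption|]. rewrite <- P1; nra. }
      nra. }
    exists w; intro x.
    assert (C1' := hcv_bounded T _ _ Lin (ex_intro _ K (conj HK Bd)) (fourier_cv f x O Cf)).
    apply (inner_limit_eq _ _ _ _ _ _ C1' Hw). intro n. rewrite linear_lincomb by assumption.
    unfold lincomb; rewrite inner_hsum_l, inner_hsum_r; apply csum_ext; intros i _.
    rewrite hinner_scal_l, inner_scal_r, (hinner_conj H y (T (f i))); fold (c i).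
    apply Cpx_ext; simpl; ring. }
  destruct (choice _ E) as [Tad HT]. exists Tad; intros x y; apply HT.
Qed.

Lemma adjoint_sym T Tad x y : adjoint T Tad -> hinner (Tad x) y = hinner x (T y).
Proof. intro A. rewrite hinner_conj, <- A, <- hinner_conj; reflexivity. Qed.

Lemma adjoint_linear T Tad : adjoint T Tad -> linear_op Tad.
Proof.
  intro A; split; intros; apply inner_ext; intro z.
  - rewrite hinner_add_l, !(adjoint_sym T Tad) by assumption; apply hinner_add_l.
  - rewrite hinner_scal_l, !(adjoint_sym T Tad) by assumption; apply hinner_scal_l.
Qed.

Lemma nsq_adjoint_le T Tad x : adjoint T Tad -> nsq (Tad x) <= hnorm (T (Tad x)) * hnorm x.
Proof.
  intro A. unfold nsq; rewrite <- A.
  eapply Rle_trans; [apply Rle_abs|]. eapply Rle_trans; [apply Cmod_re | apply cauchy_schwarz_norm].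
Qed.

Lemma adjoint_bounded T Tad : bounded_op T -> adjoint T Tad -> bounded_op Tad.
Proof.
  intros (K & HK & Bd) A; exists K; split; [assumption|]. intro x.
  assert (L := nsq_adjoint_le T Tad x A). specialize (Bd (Tad x)). rewrite <- norm_sqr in L.
  assert (P1 := norm_pos (Tad x)); assert (P2 := norm_pos x).
  destruct P1 as [P1|P1]; [|rewrite <- P1; nra].
  apply (Rmult_le_reg_r (hnorm (Tad x))); [assumption|]. nra.
Qed.

(** Schauder's theorem, from [nsq (T^* x) <= |T T^* x| |x|] and the compactness of [T T^*]. *)
Lemma adjoint_compact T Tad : compact_op T -> adjoint T Tad -> compact_op Tad.
Proof.
  intros CT A. assert (L := adjoint_linear T Tad A).
  apply (compact_dominated Tad (fun x => T (Tad x))); [assumption | | intro; apply nsq_adjoint_le; assumption].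
  apply (compact_comp_r Tad T); auto. apply (adjoint_bounded T); auto using compact_bounded.
Qed.

(** * Schatten sums *)

Lemma Cmod_sqr a : Cmod a * Cmod a = Cn2 a.
Proof. rewrite <- Cmod_pow2; ring. Qed.

Lemma rpow_Cmod a p : rpow (Cmod a) p = rpow (Cn2 a) (p / 2).
Proof. rewrite <- Cmod_sqr, rpow_sqr; [reflexivity | apply sqrt_pos]. Qed.

Lemma Cn2_conj x y : Cn2 (hinner x y) = Cn2 (hinner y x).
Proof. rewrite (hinner_conj H y x); unfold Cn2; simpl; ring. Qed.

(** Testing the bound at [z = u j] and keeping one term gives [nsq (u j) ^ 2 <= C * nsq (u j)]. *)
Lemma nsq_le_of_bessel (u : nat -> H) C K j : 0 <= C -> (j < K)%nat ->
  (forall z, rsum (fun j => Cn2 (hinner z (u j))) K <= C * nsq z) -> nsq (u j) <= C.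
Proof.
  intros HC Hj Be. specialize (Be (u j)).
  assert (L : Cn2 (hinner (u j) (u j)) <= rsum (fun i => Cn2 (hinner (u j) (u i))) K).
  { eapply Rle_trans; [|apply (rsum_mono _ (S j) K); [intro; apply Cn2_pos | lia]].
    simpl. assert (Q := rsum_pos (fun i => Cn2 (hinner (u j) (u i))) j ltac:(intro; apply Cn2_pos)); lra. }
  rewrite inner_self in L at 1; unfold Cn2 in L at 1; simpl in L.
  assert (P := nsq_pos (u j)). destruct P as [P|P]; [|lra].
  apply (Rmult_le_reg_r (nsq (u j))); [assumption|]. lra.
Qed.

(* Jensen's inequality for the weights [Cn2 (hinner (u j) (f n))], obtained by summing the
   tangent inequality at [t j := nsq (B (u j)) / C]; no limit of powers is needed because
   the tangent inequality is linear in [nsq (B (u j))]. *)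
Lemma schatten_sum_bound B f (lam : nat -> R) (u : nat -> H) q C N K :
  ons f -> complete_seq f ->
  (forall x n, hinner (B x) (f n) = Cmul (RtoC (lam n)) (hinner x (f n))) ->
  1 <= q -> 0 < C ->
  (forall z, rsum (fun j => Cn2 (hinner z (u j))) K <= C * nsq z) ->
  (forall J, rsum (fun n => rpow (lam n * lam n) q) J <= N) ->
  rsum (fun j => rpow (nsq (B (u j))) q) K <= rpow C q * N.
Proof.
  intros O Cf Ev Hq HC Be HN.
  set (t := fun j => nsq (B (u j)) / C). set (w := fun j n => Cn2 (hinner (u j) (f n))).
  assert (Pt : forall j, 0 <= t j).
  { intro j; unfold t; apply Rmult_le_pos; [apply nsq_pos | left; apply Rinv_0_lt_compat; assumption]. }
  assert (Pw : forall j n, 0 <= w j n) by (intros; apply Cn2_pos).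
  assert (Nc : 0 <= N) by (apply Rle_trans with (rsum (fun n => rpow (lam n * lam n) q) 0); [simpl; lra | apply HN]).
  set (c := fun j => q * rpow (t j) (q - 1)).
  set (X := rsum (fun j => rpow (t j) q) K).
  assert (Step : forall J, rsum (fun j => c j * rsum (fun n => Cn2 (hinner (B (u j)) (f n))) J) K
            <= C * N + (q - 1) * (C * X)).
  { intro J.
    apply Rle_trans with (rsum (fun j => rsum (fun n => w j n * rpow (lam n * lam n) q) J
                                  + (q - 1) * (rpow (t j) q * rsum (w j) J)) K).
    - apply rsum_le; intros j _. rewrite <- !rsum_scal, <- rsum_plus. apply rsum_le; intros n _.
      rewrite Ev, Cn2_mul. fold (w j n).
      replace (Cn2 (RtoC (lam n))) with (lam n * lam n) by (unfold Cn2; simpl; ring).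
      assert (Tg := rpow_tangent (lam n * lam n) (t j) q ltac:(nra) (Pt j) Hq).
      apply (Rmult_le_compat_l (w j n)) in Tg; [|apply Pw]. unfold c; lra.
    (* The sum of [w j n] over [j] is at most [C] by [Be] at [f n]; over [n] it is at most
       [nsq (u j) <= C] by Bessel for [f]. *)
    - rewrite rsum_plus, rsum_scal. apply Rplus_le_compat.
      + rewrite rsum_swap. apply Rle_trans with (rsum (fun n => C * rpow (lam n * lam n) q) J).
        * apply rsum_le; intros n _.
          rewrite (rsum_ext _ (fun j => rpow (lam n * lam n) q * w j n)) by (intros; ring).
          rewrite rsum_scal, Rmult_comm. apply Rmult_le_compat_r; [apply rpow_pos|].
          apply Rle_trans with (C * nsq (f n)).
          -- eapply Rle_trans; [|apply (Be (f n))]. apply Req_le, rsum_ext; intros; apply Cn2_conj.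
          -- assert (L := ons_nsq_le1 f n O). nra.
        * rewrite rsum_scal; apply Rmult_le_compat_l; [lra | apply HN].
      + apply Rmult_le_compat_l; [lra|]. unfold X; rewrite <- rsum_scal; apply rsum_le; intros j Hj.
        rewrite Rmult_comm; apply Rmult_le_compat_r; [apply rpow_pos|].
        apply Rle_trans with (nsq (u j)); [apply bessel; assumption|].
        apply (nsq_le_of_bessel u C K); auto; lra. }
  assert (Lim : Un_cv (fun J => rsum (fun j => c j * rsum (fun n => Cn2 (hinner (B (u j)) (f n))) J) K)
            (rsum (fun j => c j * nsq (B (u j))) K)).
  { apply (Un_cv_rsum (fun j J => c j * rsum (fun n => Cn2 (hinner (B (u j)) (f n))) J)).
    intros j _. apply (CV_mult (fun _ => c j)); [apply Un_cv_const|]. apply (parseval f (B (u j))); assumption. }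
  assert (L := Un_cv_le_bound _ _ _ 0 Lim (fun n _ => Step n)).
  assert (E1 : rsum (fun j => c j * nsq (B (u j))) K = q * C * X).
  { unfold X; rewrite <- rsum_scal; apply rsum_ext; intros j _.
    rewrite (rpow_split (t j) q) by apply Pt. unfold c, t; field; lra. }
  assert (E2 : rsum (fun j => rpow (nsq (B (u j))) q) K = rpow C q * X).
  { unfold X; rewrite <- rsum_scal; apply rsum_ext; intros j _.
    rewrite <- rpow_mult; [|lra|apply Pt]. f_equal; unfold t; field; lra. }
  rewrite E2; apply Rmult_le_compat_l; [apply rpow_pos|].
  (* What remains is [q C X <= C N + (q - 1) C X] with [X] a finite sum, so [X <= N]. *)
  rewrite E1 in L. apply (Rmult_le_reg_l C); [assumption|]. lra.
Qed.

Lemma matrix_sum_bound T (u : nat -> H) p C N K : 2 <= p -> 0 <= C ->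
  (forall z, rsum (fun j => Cn2 (hinner z (u j))) K <= C * nsq z) ->
  rsum (fun j => rpow (nsq (T (u j))) (p / 2)) K <= N ->
  rsum (fun n => rsum (fun k => matrix_p T u p (n, k)) K) K <= rpow C (p / 2) * N.
Proof.
  intros Hp HC Be HN.
  apply Rle_trans with (rsum (fun n => rpow C (p / 2) * rpow (nsq (T (u n))) (p / 2)) K).
  - apply rsum_le; intros n _. rewrite <- rpow_mult; [|assumption|apply nsq_pos].
    rewrite (rsum_ext _ (fun k => rpow (Cn2 (hinner (T (u n)) (u k))) (p / 2))).
    + apply rsum_rpow_le; [intro; apply Cn2_pos | lra | apply Be].
    + intros k _; unfold matrix_p; simpl. apply rpow_Cmod.
  - rewrite rsum_scal; apply Rmult_le_compat_l; [apply rpow_pos | assumption].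
Qed.

(** * Counting eigenvalues *)

(** Multiplicity at least [m], in the exact form used by the multiplicity clause of
    [singular_values]. *)
Definition occurs (a : nat -> R) (mu : R) (m : nat) : Prop :=
  exists g : nat -> nat,
    (forall i j, (i < m)%nat -> (j < m)%nat -> g i = g j -> i = j) /\
    (forall i, (i < m)%nat -> a (g i) = mu).

Lemma occurs_list (a : nat -> R) mu l :
  NoDup l -> (forall n, In n l -> a n = mu) -> occurs a mu (length l).
Proof.
  intros D E; exists (fun i => nth i l 0%nat); split.
  - intros i j Hi Hj Eq; exact (proj1 (NoDup_nth l 0%nat) D i j Hi Hj Eq).
  - intros i Hi; apply E, nth_In; assumption.
Qed.

Lemma lsum_rsum_swap {I : Type} (F : nat -> I -> R) m (l : list I) :
  rsum (fun i => lsum (F i) l) m = lsum (fun k : I => rsum (fun i => F i k) m) l.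
Proof.
  induction l; [unfold lsum; simpl; apply rsum_zero|].
  rewrite lsum_cons, <- IHl, <- rsum_plus; apply rsum_ext; intros; apply lsum_cons.
Qed.

Lemma lsum_le_length {I : Type} (h : I -> R) l : (forall i, h i <= 1) -> lsum h l <= INR (length l).
Proof.
  intro P; induction l; [unfold lsum; simpl; lra|].
  rewrite lsum_cons; simpl length; rewrite S_INR; specialize (P a); lra.
Qed.

(* If only [k < m] basis vectors had eigenvalue [mu], Parseval and Bessel would give
   [m = sum_i nsq (e i) <= k]. *)
Lemma eigenvalue_occurs A f mu m (e : nat -> H) :
  symmetric_op A -> ons f -> complete_seq f -> (forall n, eigenvec A (f n)) ->
  (forall i j, (i < m)%nat -> (j < m)%nat ->
     hinner (e i) (e j) = if Nat.eq_dec i j then C1 else C0) ->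
  (forall i, (i < m)%nat -> A (e i) = hscal (RtoC mu) (e i)) ->
  occurs (fun n => re (hinner (A (f n)) (f n))) mu m.
Proof.
  intros Sy O Cf Ev Oe Ee. set (lam := fun n => re (hinner (A (f n)) (f n))).
  assert (Q : forall k, (k <= m)%nat -> exists l, NoDup l /\ length l = k /\ forall n, In n l -> lam n = mu).
  2:{ destruct (Q m (Nat.le_refl m)) as (l & D & <- & E); apply occurs_list; assumption. }
  induction k; intro Hk; [exists nil; repeat split; [constructor | intros ? []]|].
  destruct IHk as (l & D & Len & E); [lia|].
  destruct (classic (exists n, ~ In n l /\ lam n = mu)) as [(n & Hn & En)|N].
  { exists (n :: l); split; [constructor; assumption|]. split; [simpl; congruence|].
    intros n' [<-|Hn']; auto. }
  exfalso.
  (* By [N], every index outside [l] carries an eigenvalue other than [mu], and symmetry makes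
     eigenvectors of different eigenvalues orthogonal. *)
  assert (Out : forall i n, (i < m)%nat -> ~ In n l -> hinner (e i) (f n) = C0).
  { intros i n Hi Hn. assert (Ne : mu <> lam n) by (intro Q; apply N; exists n; auto).
    assert (S := Sy (e i) (f n)). rewrite Ee, (Ev n) in S by assumption. fold (lam n) in S.
    rewrite hinner_scal_l, inner_scal_r in S.
    assert (S1 := f_equal re S); assert (S2 := f_equal im S); simpl in S1, S2.
    apply Cpx_ext; simpl; apply (Rmult_eq_reg_l (mu - lam n)); lra. }
  assert (One : forall i, (i < m)%nat -> 1 <= lsum (fun n => Cn2 (hinner (e i) (f n))) l).
  { intros i Hi. assert (U : nsq (e i) = 1).
    { unfold nsq; rewrite Oe by assumption; destruct (Nat.eq_dec i i); [reflexivity | easy]. }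
    assert (C := parseval f (e i) O Cf). rewrite U in C.
    apply (Un_cv_le_bound _ _ _ 0 C). intros J _. rewrite <- lsum_seq.
    apply lsum_support; [intro; apply Cn2_pos | apply seq_NoDup|].
    intros n _. destruct (classic (In n l)) as [I|I]; [right; assumption|left].
    rewrite Out by assumption; unfold Cn2; simpl; ring. }
  (* Nothing is known about [e] from index [m] on; zeros there give a padded orthonormal sequence to
     which Bessel applies. *)
  set (e' := fun i => if Compare_dec.lt_dec i m then e i else hzero).
  assert (Oe' : ons e').
  { split.
    - intro n; unfold e'; destruct (Compare_dec.lt_dec n m); [right|left; reflexivity].
      rewrite Oe by assumption; destruct (Nat.eq_dec n n); easy.
    - intros n n' Ne; unfold e'; destruct (Compare_dec.lt_dec n m); [|apply inner_zero_l].
      destruct (Compare_dec.lt_dec n' m); [|apply inner_zero_r].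
      rewrite Oe by assumption; destruct (Nat.eq_dec n n'); easy. }
  assert (L1 : INR m <= rsum (fun i => lsum (fun n => Cn2 (hinner (e i) (f n))) l) m).
  { replace (INR m) with (rsum (fun _ => 1) m); [apply rsum_le; assumption|].
    clear; induction m; [reflexivity|]. rewrite S_INR; simpl; lra. }
  rewrite lsum_rsum_swap in L1.
  assert (L2 : lsum (fun n => rsum (fun i => Cn2 (hinner (e i) (f n))) m) l <= INR (length l)).
  { apply lsum_le_length. intro n.
    eapply Rle_trans; [|apply (ons_nsq_le1 f n O)]. eapply Rle_trans; [|apply (bessel e' (f n) m Oe')].
    apply rsum_le; intros i Hi. unfold e'; destruct (Compare_dec.lt_dec i m); [|easy]. rewrite Cn2_conj; lra. }
  assert (L3 : INR (length l) < INR m) by (apply lt_INR; lia). lra.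
Qed.

End Adjoint.

(** * Transfer of sums between sequences with comparable multiplicities *)

Lemma filter_map_length {I J : Type} (P : R -> bool) (a : I -> R) (s : J -> R) l l' :
  map s l' = map a l -> length (filter (fun j => P (s j)) l') = length (filter (fun i => P (a i)) l).
Proof.
  revert l; induction l' as [|y l' IH]; intros [|x l] E; try discriminate; [reflexivity|].
  simpl in *. injection E as E1 E2. rewrite E1; destruct (P (a x)); simpl; auto.
Qed.

(** Induction on [l]: if every position of the value [a x] in [s] were already used, [l'] would hold
    at least as many of them as [x :: l] does, yet it holds as many as [l], one fewer. *)
Lemma embed_list (a s : nat -> R) :
  (forall mu m, 0 < mu -> occurs a mu m -> occurs s mu m) ->
  forall l, NoDup l -> (forall n, In n l -> 0 < a n) -> exists l', NoDup l' /\ map s l' = map a l.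
Proof.
  intros Emb; induction l as [|x l IH]; intros D P; [exists nil; split; [constructor | reflexivity]|].
  inversion D as [|? ? Hx Dl]; subst.
  destruct IH as (l' & D' & E'); [assumption | intros; apply P; right; assumption|].
  set (mu := a x). set (test := fun r => if Req_dec_T r mu then true else false).
  set (lx := filter (fun n => test (a n)) (x :: l)).
  assert (Oc : occurs a mu (length lx)).
  { apply occurs_list; [apply NoDup_filter; assumption|]. intros n Hn; apply filter_In in Hn.
    destruct Hn as [_ Hn]; unfold test in Hn; destruct (Req_dec_T (a n) mu); easy. }
  apply Emb in Oc; [|apply P; left; reflexivity]. destruct Oc as (g & Ig & Eg).
  assert (Y : exists y, ~ In y l' /\ s y = mu).
  { apply NNPP; intro N.
    assert (Le : (length (map g (seq 0 (length lx))) <= length (filter (fun n => test (s n)) l'))%nat).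
    { apply NoDup_incl_length.
      - apply NoDup_map_NoDup_ForallPairs; [|apply seq_NoDup].
        intros i j Hi Hj; apply in_seq in Hi; apply in_seq in Hj; apply Ig; lia.
      - intros y Hy; apply in_map_iff in Hy; destruct Hy as (i & <- & Hi); apply in_seq in Hi.
        assert (Ei := Eg i ltac:(lia)). apply filter_In; split.
        + apply NNPP; intro M; apply N; exists (g i); auto.
        + unfold test; destruct (Req_dec_T (s (g i)) mu); easy. }
    rewrite length_map, length_seq, (filter_map_length test a s l l' E') in Le.
    unfold lx in Le; simpl in Le. unfold test at 1 in Le.
    destruct (Req_dec_T (a x) mu) as [_|Ne]; [simpl in Le; lia | apply Ne; reflexivity]. }
  destruct Y as (y & Hy & Ey). exists (y :: l'); split; [constructor; assumption|].
  simpl; rewrite Ey, E'; reflexivity.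
Qed.

(** Since [nnsum_le] looks at finite lists only, no global injection between the sequences has to be
    built; zero terms, whose multiplicity is uncontrolled, are filtered out first. *)
Lemma nnsum_embed (a s : nat -> R) (phi : R -> R) M :
  (forall mu m, 0 < mu -> occurs a mu m -> occurs s mu m) ->
  (forall n, 0 <= a n) -> (forall r, 0 <= phi r) -> phi 0 = 0 ->
  nnsum_le (fun n => phi (s n)) M -> nnsum_le (fun n => phi (a n)) M.
Proof.
  intros Emb Pa Pphi phi0 B l D.
  set (pos := fun n => if Rlt_dec 0 (a n) then true else false).
  destruct (embed_list a s Emb (filter pos l)) as (l' & D' & E').
  { apply NoDup_filter; assumption. }
  { intros n Hn; apply filter_In in Hn; destruct Hn as [_ Hn]; unfold pos in Hn.
    destruct (Rlt_dec 0 (a n)); easy. }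
  apply Rle_trans with (lsum (fun n => phi (a n)) (filter pos l)).
  - apply lsum_support; auto. intros n Hn. destruct (Rlt_dec 0 (a n)) as [L|L].
    + right; apply filter_In; split; [assumption|]. unfold pos; destruct (Rlt_dec 0 (a n)); easy.
    + left. replace (a n) with 0; [assumption|]. specialize (Pa n); lra.
  - eapply Rle_trans; [|apply (B l' D')]. apply Req_le, lsum_eq.
    rewrite <- (map_map a phi), <- (map_map s phi), E'; reflexivity.
Qed.

(** * Decreasing rearrangement *)

Lemma list_argmax (a : nat -> R) (l : list nat) x : In x l ->
  exists n, In n l /\ forall m, In m l -> a m <= a n.
Proof.
  revert x; induction l as [|y l IH]; intros x Hx; [destruct Hx|].
  destruct l as [|z l].
  - exists y; split; [left; reflexivity|]. intros m [<-|[]]; lra.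
  - destruct (IH z (or_introl eq_refl)) as (n & Hn & Mn).
    destruct (Rle_lt_dec (a n) (a y)) as [L|L].
    + exists y; split; [left; reflexivity|]. intros m [<-|Hm]; [lra|]. specialize (Mn m Hm); lra.
    + exists n; split; [right; assumption|]. intros m [<-|Hm]; [lra | auto].
Qed.

(** If a positive value remains outside [L], only finitely many terms can reach it; otherwise all
    remaining terms are 0 and any index outside [L] works. *)
Lemma argmax_outside (a : nat -> R) (L : list nat) : (forall n, 0 <= a n) -> Un_cv a 0 ->
  exists n, ~ In n L /\ forall m, ~ In m L -> a m <= a n.
Proof.
  intros P C.
  destruct (classic (exists n, ~ In n L /\ 0 < a n)) as [(n & Hn & Pn)|N].
  - destruct (C (a n) Pn) as [N HN].
    set (out := fun m => if in_dec Nat.eq_dec m L then false else true).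
    assert (Iff : forall m, out m = true <-> ~ In m L).
    { intro m; unfold out; destruct (in_dec Nat.eq_dec m L); split; easy. }
    destruct (list_argmax a (filter out (seq 0 (max N (S n)))) n) as (k & Hk & Mk).
    { apply filter_In; split; [apply in_seq; lia | apply Iff; assumption]. }
    apply filter_In in Hk; destruct Hk as [_ Hk]; apply Iff in Hk.
    exists k; split; [assumption|]. intros m Hm.
    destruct (Nat.lt_ge_cases m N) as [Q|Q].
    + apply Mk, filter_In; split; [apply in_seq; lia | apply Iff; assumption].
    + assert (In n (filter out (seq 0 (max N (S n))))) as In1
        by (apply filter_In; split; [apply in_seq; lia | apply Iff; assumption]).
      specialize (Mk n In1). specialize (HN m Q). unfold Rdist in HN.
      rewrite Rminus_0_r in HN; apply Rabs_def2 in HN; lra.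
  - destruct (list_nat_bound L) as [n Hn]. exists n; split.
    + intro I; apply Hn, in_seq in I; lia.
    + intros m Hm. assert (Q := P n). apply Rnot_lt_le; intro Lt; apply N; exists m; split; [assumption | lra].
Qed.

(** Greedy selection of a largest remaining term. A positive term never picked would bound
    infinitely many distinct terms from below, against convergence to 0; zero terms may be missed
    for good. *)
Lemma decreasing_rearrangement (a : nat -> R) : (forall n, 0 <= a n) -> Un_cv a 0 ->
  exists sg : nat -> nat, (forall i j, sg i = sg j -> i = j) /\
    (forall k, a (sg (S k)) <= a (sg k)) /\ (forall n, 0 < a n -> exists k, sg k = n).
Proof.
  intros P C. destruct (choice _ (fun L => argmax_outside a L P C)) as [pick Hpick].
  set (pre := fix pre (k : nat) : list nat :=
    match k with O => nil | S k => pick (pre k) :: pre k end).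
  set (sg := fun k => pick (pre k)).
  assert (Mem : forall k j, (j < k)%nat -> In (sg j) (pre k)).
  { induction k; intros j Hj; [lia|]. simpl. destruct (Nat.eq_dec j k) as [->|N]; [left; reflexivity|].
    right; apply IHk; lia. }
  assert (Pre : forall k x, In x (pre k) -> exists j, sg j = x).
  { induction k; simpl; intros x; [easy|]. intros [<-|Hx]; [exists k; reflexivity | auto]. }
  assert (Lt : forall i j, (i < j)%nat -> sg i <> sg j).
  { intros i j Hij E. apply (proj1 (Hpick (pre j))). fold (sg j); rewrite <- E; apply Mem; assumption. }
  assert (Inj : forall i j, sg i = sg j -> i = j).
  { intros i j E. destruct (Nat.lt_trichotomy i j) as [Q|[Q|Q]]; [|assumption|]; exfalso;
      [apply (Lt i j) | apply (Lt j i)]; auto. }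
  exists sg; split; [assumption|]. split.
  - intro k. apply (proj2 (Hpick (pre k))). intro I.
    apply (proj1 (Hpick (pre (S k)))). right; assumption.
  - intros n Pn. apply NNPP; intro N.
    assert (Le : forall k, a n <= a (sg k)).
    { intro k; apply (proj2 (Hpick (pre k))). intro I; apply N, (Pre k n I). }
    destruct (C (a n) Pn) as [m Hm].
    assert (Sm : forall k, (sg k < m)%nat).
    { intro k. apply Nat.nle_gt; intro Q. specialize (Hm (sg k) Q). specialize (Le k).
      unfold Rdist in Hm; rewrite Rminus_0_r in Hm; apply Rabs_def2 in Hm; lra. }
    assert (Q : (length (map sg (seq 0 (S m))) <= length (seq 0 m))%nat).
    { apply NoDup_incl_length.
      - apply NoDup_map_NoDup_ForallPairs; [|apply seq_NoDup]. intros i j _ _; apply Inj.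
      - intros x Hx; apply in_map_iff in Hx; destruct Hx as (k & <- & _).
        apply in_seq; specialize (Sm k); lia. }
    rewrite length_map, !length_seq in Q; lia.
Qed.

Lemma rpow_bounded_cv0 (a : nat -> R) p X : 0 <= p -> (forall n, 0 <= a n) ->
  (forall J, rsum (fun n => rpow (a n) p) J <= X) -> Un_cv a 0.
Proof.
  intros Hp P B eps He.
  destruct (infinite_sum_of_bounded _ X (fun n => rpow_pos (a n) p) B) as [l Hl].
  apply infinite_sum_rsum in Hl.
  assert (Pe := rpow_lt0 eps p He). destruct (Hl (rpow eps p / 2)) as [N HN]; [lra|].
  exists N; intros n Hn. unfold Rdist; rewrite Rminus_0_r, Rabs_right by (apply Rle_ge; auto).
  apply Rnot_le_lt; intro Le. assert (M := rpow_le _ _ p Hp Le).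
  assert (A := HN n Hn); assert (A' := HN (S n) ltac:(lia)). simpl in A'.
  unfold Rdist in A, A'; apply Rabs_def2 in A; apply Rabs_def2 in A'; lra.
Qed.

(** * Bases, frames and matrix sums *)

Section Schatten.
Context {H : HilbertSpace}.
Implicit Types (T B A : H -> H) (f u : nat -> H) (x y z : H).

Lemma matrix_p_pos {I : Type} T (e : I -> H) p nk : 0 <= matrix_p T e p nk.
Proof. apply rpow_pos. Qed.

Lemma nnsum_le_pullback {I : Type} T (e : I -> H) f (g : I -> nat) p M :
  (forall i j, g i = g j -> i = j) -> (forall i, f (g i) = e i) ->
  nnsum_le (matrix_p T f p) M -> nnsum_le (matrix_p T e p) M.
Proof.
  intros Inj E B l D. set (gg := fun ij : I * I => (g (fst ij), g (snd ij))).
  assert (Dm : NoDup (map gg l)).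
  { apply NoDup_map_NoDup_ForallPairs; [|assumption]. intros [i j] [i' j'] _ _ Q.
    unfold gg in Q; simpl in Q; injection Q as Q1 Q2; f_equal; auto. }
  eapply Rle_trans; [|apply (B _ Dm)]. apply Req_le.
  change (lsum (matrix_p T e p) l = lsum (matrix_p T f p) (map gg l)).
  rewrite lsum_map. apply lsum_eq, map_ext. intros [i j]; unfold matrix_p, gg; simpl.
  rewrite !E; reflexivity.
Qed.

(** The diagonal is part of the double sum, and padding contributes [rpow 0 p = 0]. *)
Lemma diagonal_sum_le {I : Type} T (e : I -> H) f (g : I -> nat) p M J :
  (forall i, f (g i) = e i) -> (forall n, (exists i, g i = n) \/ f n = hzero) ->
  nnsum_le (matrix_p T e p) M -> rsum (fun n => rpow (Cmod (hinner (T (f n)) (f n))) p) J <= M.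
Proof.
  intros E Z B.
  assert (L : exists l, NoDup l /\ (forall i, In i l -> (g i < J)%nat) /\
     rsum (fun n => rpow (Cmod (hinner (T (f n)) (f n))) p) J = lsum (fun i => matrix_p T e p (i, i)) l).
  { induction J as [|J (l & D & Lt & S)].
    - exists nil; split; [constructor|]. split; [intros ? [] | reflexivity].
    - simpl; rewrite S. destruct (Z J) as [[i Hi]|E0].
      + exists (i :: l); split; [|split].
        * constructor; [|assumption]. intro Q; apply Lt in Q; lia.
        * intros j [<-|Hj]; [lia|]. apply Lt in Hj; lia.
        * rewrite lsum_cons. unfold matrix_p at 2; simpl. rewrite <- Hi, E; ring.
      + exists l; split; [assumption|]. split; [intros j Hj; apply Lt in Hj; lia|].
        rewrite E0, inner_zero_r. replace (Cmod C0) with 0.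
        * rewrite rpow_0; ring.
        * unfold Cmod; simpl. rewrite Rmult_0_l, Rplus_0_r, sqrt_0; reflexivity. }
  destruct L as (l & D & _ & ->).
  rewrite <- (lsum_map (fun i => (i, i))). apply B.
  apply NoDup_map_NoDup_ForallPairs; [|assumption]. intros i j _ _ Q; congruence.
Qed.

Lemma frame_coeff_sum_n2 f x n : frame_coeff_sum f x n = Cn2 (hinner x (f n)).
Proof. apply Cmod_pow2. Qed.

Lemma padded_parseval f x : ons f -> complete_seq f -> infinite_sum (frame_coeff_sum f x) (nsq x).
Proof.
  intros O Cf; apply infinite_sum_rsum.
  apply (Un_cv_ext (rsum (fun i => Cn2 (hinner x (f i))))); [|apply parseval; assumption].
  intro n; apply rsum_ext; intros; symmetry; apply frame_coeff_sum_n2.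
Qed.

Lemma padded_is_frame f : ons f -> complete_seq f -> is_frame f.
Proof.
  intros O Cf; exists 1, 1; split; [lra|]. split; [lra|]. intro x; exists (nsq x).
  rewrite norm_pow2; split; [apply padded_parseval; assumption | lra].
Qed.

Lemma padded_upper_bound f : ons f -> complete_seq f -> upper_frame_bound_le f 1.
Proof.
  intros O Cf eps He x; exists (nsq x).
  rewrite norm_pow2; split; [apply padded_parseval; assumption|]. assert (P := nsq_pos x); nra.
Qed.

Lemma admissible_bessel f C z K : admissible_upper_bound f C ->
  rsum (fun j => Cn2 (hinner z (f j))) K <= C * nsq z.
Proof.
  intro A; destruct (A z) as (L & S & B). rewrite norm_pow2 in B.
  eapply Rle_trans; [|exact B].
  rewrite (rsum_ext _ (frame_coeff_sum f z)) by (intros; symmetry; apply frame_coeff_sum_n2).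
  apply infinite_sum_ge_rsum; [|assumption]. intro i; rewrite frame_coeff_sum_n2; apply Cn2_pos.
Qed.

Lemma upper_frame_bound_bessel f b z K : upper_frame_bound_le f b ->
  rsum (fun j => Cn2 (hinner z (f j))) K <= b * nsq z.
Proof.
  intro U. assert (P := nsq_pos z). apply le_epsilon; intros eps He.
  (* The slack in the frame bound is chosen so that, multiplied by [nsq z], it stays below [eps]. *)
  assert (Q : 0 < eps / (nsq z + 1)) by (apply Rdiv_lt_0_compat; lra).
  eapply Rle_trans; [apply (admissible_bessel f _ z K (U _ Q))|].
  assert (E : eps / (nsq z + 1) * (nsq z + 1) = eps) by (field; lra). nra.
Qed.

(** * Control of a compact operator by its diagonal entries *)

Lemma padded_eigenbasis_of {I : Type} B (e : I -> H) (g : I -> nat) f : linear_op B ->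
  (forall i, f (g i) = e i) -> (forall n, (exists i, g i = n) \/ f n = hzero) ->
  (forall i, eigenvec B (e i)) -> forall n, eigenvec B (f n).
Proof.
  intros L E Z Ev n. destruct (Z n) as [[i <-]|E0]; [rewrite E; apply Ev|].
  unfold eigenvec; rewrite E0, linear_zero by assumption; hext; ring.
Qed.

Lemma eigenvec_coef B f x n : symmetric_op B -> eigenvec B (f n) ->
  hinner (B x) (f n) = Cmul (RtoC (re (hinner (B (f n)) (f n)))) (hinner x (f n)).
Proof.
  intros Sy Ev; rewrite Sy. unfold eigenvec in Ev; rewrite Ev at 1.
  rewrite inner_scal_r; apply Cpx_ext; simpl; ring.
Qed.

(** The basis is fixed before [M] and [u]: one eigenbasis of [B] controls all orthonormal sequences
    at once. *)
Lemma symmetric_part_control T B p : separable H -> compact_op B -> symmetric_op B -> 2 <= p ->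
  (forall x, Rabs (re (hinner (B x) x)) <= Cmod (hinner (T x) x)) ->
  exists (I : Type) (e : I -> H), orthonormal_basis e /\
    forall M, nnsum_le (matrix_p T e p) M -> forall u K, ons u ->
      rsum (fun j => rpow (nsq (B (u j))) (p / 2)) K <= M.
Proof.
  intros Sep CB Sy Hp D. destruct (eigenbasis_exists B CB Sy) as (I & e & Oe & Ev).
  exists I, e; split; [assumption|]. intros M HM u K Ou.
  destruct (padded_of_basis e Sep Oe) as (g & f & Inj & E & Z & O & Cf).
  assert (Evf := padded_eigenbasis_of B e g f (proj1 CB) E Z Ev).
  replace M with (rpow 1 (p / 2) * M).
  2:{ rewrite rpow_gt0 by lra. unfold Rpower; rewrite ln_1, Rmult_0_r, exp_0; ring. }
  apply (schatten_sum_bound B f (fun n => re (hinner (B (f n)) (f n)))); auto; try lra.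
  - intros x n; apply eigenvec_coef; auto.
  - intro z; rewrite Rmult_1_l; apply bessel; assumption.
  - intro J. eapply Rle_trans; [|apply (diagonal_sum_le T e f g p M J E Z HM)].
    apply rsum_le; intros n _. rewrite rpow_Cmod. apply rpow_le; [lra|].
    rewrite <- Cmod_sqr. assert (Q := D (f n)). assert (Q0 := Rabs_pos (re (hinner (B (f n)) (f n)))).
    replace (re (hinner (B (f n)) (f n)) * re (hinner (B (f n)) (f n)))
      with (Rabs (re (hinner (B (f n)) (f n))) * Rabs (re (hinner (B (f n)) (f n)))).
    + nra.
    + rewrite <- Rabs_mult, Rabs_right; [reflexivity | nra].
Qed.

Definition re_part T Tad : H -> H := fun x => hscal (mkC (/ 2) 0) (hadd (T x) (Tad x)).
(** The scalar is [1 / (2 i)], which makes this part symmetric and gives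
    [T = re_part + i im_part]. *)
Definition im_part T Tad : H -> H :=
  fun x => hscal (mkC 0 (- / 2)) (hadd (T x) (hscal (mkC (-1) 0) (Tad x))).

(** With [q = p / 2], one factor [2^q] comes from [nsq (T x) <= 2 (a + b)], and [2^q / 2] from
    convexity in [(a + b)^q]; the remaining 2 is kept on the left. *)
Lemma cartesian_control T Tad p : separable H -> compact_op T -> adjoint T Tad -> 2 <= p ->
  exists (I1 : Type) (e1 : I1 -> H) (I2 : Type) (e2 : I2 -> H),
    orthonormal_basis e1 /\ orthonormal_basis e2 /\
    forall M1 M2, nnsum_le (matrix_p T e1 p) M1 -> nnsum_le (matrix_p T e2 p) M2 ->
      forall u K, ons u ->
      2 * rsum (fun j => rpow (nsq (T (u j))) (p / 2)) K <= rpow 4 (p / 2) * (M1 + M2).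
Proof.
  intros Sep CT Ad Hp. assert (CA := adjoint_compact T Tad CT Ad).
  assert (Ads : forall x y, hinner (Tad x) y = hinner x (T y)) by (intros; apply adjoint_sym; assumption).
  destruct (symmetric_part_control T (re_part T Tad) p Sep) as (I1 & e1 & O1 & B1).
  { apply compact_scal, compact_add; assumption. }
  { intros x y; unfold re_part; autorewrite with inner. rewrite Ads, Ad. apply Cpx_ext; simpl; ring. }
  { assumption. }
  { intro x. eapply Rle_trans; [|apply Cmod_re]. apply Req_le; f_equal.
    unfold re_part; autorewrite with inner. rewrite Ads, (hinner_conj H (T x) x); simpl; field. }
  destruct (symmetric_part_control T (im_part T Tad) p Sep) as (I2 & e2 & O2 & B2).
  { apply compact_scal, compact_add; [|apply compact_scal]; assumption. }
  { intros x y; unfold im_part; autorewrite with inner. rewrite Ads, Ad. apply Cpx_ext; simpl; ring. }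
  { assumption. }
  { intro x. eapply Rle_trans; [|apply Cmod_im]. apply Req_le; f_equal.
    unfold im_part; autorewrite with inner. rewrite Ads, (hinner_conj H (T x) x); simpl; field. }
  exists I1, e1, I2, e2; split; [assumption|]. split; [assumption|].
  intros M1 M2 H1 H2 u K Ou. specialize (B1 M1 H1 u K Ou). specialize (B2 M2 H2 u K Ou).
  apply Rle_trans with (rpow 4 (p / 2) * (rsum (fun j => rpow (nsq (re_part T Tad (u j))) (p / 2)) K
                          + rsum (fun j => rpow (nsq (im_part T Tad (u j))) (p / 2)) K)).
  2:{ apply Rmult_le_compat_l; [apply rpow_pos | lra]. }
  rewrite <- rsum_plus, <- !rsum_scal. apply rsum_le; intros j _.
  set (x := u j). set (a := nsq (re_part T Tad x)). set (b := nsq (im_part T Tad x)).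
  assert (L : nsq (T x) <= 2 * (a + b)).
  { replace (T x) with (hadd (re_part T Tad x) (hscal (mkC 0 1) (im_part T Tad x)))
      by (unfold re_part, im_part; hext; field).
    set (v := hscal (mkC 0 1) (im_part T Tad x)).
    assert (Ev : nsq v = b) by (unfold v; rewrite nsq_scal; unfold Cn2, b; simpl; ring).
    (* Nonnegativity of the squared norm of the difference bounds the cross term by [a + b]. *)
    assert (Q := nsq_pos (hsub (re_part T Tad x) v)). rewrite nsq_sub, Ev in Q.
    rewrite nsq_add, Ev. unfold a in *; lra. }
  assert (Pa : 0 <= a) by apply nsq_pos. assert (Pb : 0 <= b) by apply nsq_pos.
  apply (rpow_le _ _ (p / 2)) in L; [|lra]. rewrite rpow_mult in L by lra.
  assert (Q := rpow_add_le a b (p / 2) Pa Pb ltac:(lra)).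
  replace 4 with (2 * 2) by ring. rewrite (rpow_mult 2 2) by lra.
  assert (P2 := rpow_pos 2 (p / 2)). nra.
Qed.

(** * Singular values *)

(** Diagonalizes the root [A], compact because [nsq (A x) <= |T^* T x| |x|]; equality of positive
    multiplicities then lets [lam] replace [s] in every sum. *)
Lemma singular_values_eigenbasis T s : separable H -> compact_op T -> singular_values T s ->
  exists A Tad f, adjoint T Tad /\ ons f /\ complete_seq f /\
    (forall n, 0 <= s n) /\
    (forall x, nsq (A x) = nsq (T x)) /\
    let lam := fun n => re (hinner (A (f n)) (f n)) in
    (forall n, 0 <= lam n) /\
    (forall x n, hinner (A x) (f n) = Cmul (RtoC (lam n)) (hinner x (f n))) /\
    (forall n, nsq (T (f n)) = lam n * lam n) /\
    (forall mu m, 0 < mu -> (occurs s mu m <-> occurs lam mu m)).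
Proof.
  intros Sep CT (Tad & A & Ad & LA & SA & PA & AA & Ms & Mult).
  assert (Nn : forall x, nsq (A x) = re (hinner (Tad (T x)) x)).
  { intro x. unfold nsq. rewrite <- SA, AA; reflexivity. }
  assert (NT : forall x, nsq (A x) = nsq (T x)).
  { intro x. rewrite Nn, (adjoint_sym T Tad) by assumption; reflexivity. }
  assert (CA : compact_op A).
  { apply (compact_dominated A (fun x => Tad (T x))); [assumption| |].
    - apply (compact_comp_l Tad T); [apply (adjoint_linear T); assumption | | assumption].
      apply (adjoint_bounded T); auto using compact_bounded.
    - intro x; rewrite Nn. eapply Rle_trans; [apply Rle_abs|].
      eapply Rle_trans; [apply Cmod_re | apply cauchy_schwarz_norm]. }
  destruct (eigenbasis_exists A CA SA) as (I & e & Oe & Ev).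
  destruct (padded_of_basis e Sep Oe) as (g & f & Inj & E & Z & O & Cf).
  assert (Evf := padded_eigenbasis_of A e g f LA E Z Ev).
  exists A, Tad, f. do 3 (split; [assumption|]).
  split; [intro n; specialize (Ms n); lra|]. split; [assumption|].
  cbv zeta; set (lam := fun n => re (hinner (A (f n)) (f n))).
  assert (Un : forall n, 0 < lam n -> hinner (f n) (f n) = C1).
  { intros n P; destruct (proj1 O n) as [E0|U]; [|assumption].
    unfold lam in P; rewrite E0, inner_zero_r in P; simpl in P; lra. }
  split; [intro; apply PA|]. split; [intros; apply eigenvec_coef; auto|]. split.
  - intro n. rewrite <- NT. rewrite (Evf n) at 1. fold (lam n). rewrite nsq_scal.
    destruct (PA (f n)) as [P|P]; fold (lam n) in P.
    + unfold nsq; rewrite Un by assumption; unfold Cn2; simpl; ring.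
    + rewrite <- P; unfold Cn2; simpl; ring.
  - intros mu m Hmu; split; intro Oc.
    + apply Mult in Oc; [|assumption]. destruct Oc as (v & Ov & Vv).
      apply (eigenvalue_occurs A f mu m v); assumption.
    + apply Mult; [assumption|]. destruct Oc as (h & Ih & Eh).
      exists (fun i => f (h i)); split.
      * intros i j Hi Hj. destruct (Nat.eq_dec i j) as [->|N].
        -- apply Un; rewrite Eh; assumption.
        -- apply (proj2 O); intro Q; apply N, Ih; assumption.
      * intros i Hi. rewrite <- (Eh i Hi). apply Evf.
Qed.

(** The Bessel constant enters twice, once through Jensen over the vectors [f j] and once through
    the sum along each row. *)
Lemma bessel_matrix_bound T s p N C f : separable H -> compact_op T -> 2 <= p -> 0 < C ->
  singular_values T s -> infinite_sum (fun n => rpow (s n) p) N ->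
  (forall z K, rsum (fun j => Cn2 (hinner z (f j))) K <= C * nsq z) ->
  nnsum_le (matrix_p T f p) (rpow C (p / 2) * (rpow C (p / 2) * N)).
Proof.
  intros Sep CT Hp HC SV Sum Be.
  destruct (singular_values_eigenbasis T s Sep CT SV)
    as (A & Tad & v & Ad & O & Cv & Ps & NT & Pl & Coef & _ & Oc).
  set (lam := fun n => re (hinner (A (v n)) (v n))) in *.
  apply nnsum_le_pairs; [apply matrix_p_pos|]. intro K.
  apply matrix_sum_bound; [assumption | lra | intro; apply Be |].
  rewrite (rsum_ext _ (fun j => rpow (nsq (A (f j))) (p / 2))) by (intros; rewrite NT; reflexivity).
  apply (schatten_sum_bound A v lam); auto; [lra|].
  intro J. rewrite (rsum_ext _ (fun n => rpow (lam n) p)) by (intros; apply rpow_sqr, Pl).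
  revert J. apply nnsum_le_rsum; [intro; apply rpow_pos|].
  apply (nnsum_embed lam s (fun r => rpow r p)); auto using rpow_pos, rpow_0.
  - intros mu m Hmu; apply Oc; assumption.
  - apply nnsum_le_rsum; [intro; apply rpow_pos|]. intro J.
    apply infinite_sum_ge_rsum; [intro; apply rpow_pos | assumption].
Qed.

(** The hypothesis is used at the eigenvectors of [A], where [nsq (T (v n))] is the square of the
    eigenvalue. *)
Lemma singular_sum_le T s p N X : separable H -> compact_op T -> 2 <= p ->
  singular_values T s -> infinite_sum (fun n => rpow (s n) p) N ->
  (forall Tad, adjoint T Tad -> forall u K, ons u -> rsum (fun j => rpow (nsq (T (u j))) (p / 2)) K <= X) ->
  N <= X.
Proof.
  intros Sep CT Hp SV Sum B.
  destruct (singular_values_eigenbasis T s Sep CT SV)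
    as (A & Tad & v & Ad & O & Cv & Ps & NT & Pl & Coef & NTv & Oc).
  set (lam := fun n => re (hinner (A (v n)) (v n))) in *.
  apply (infinite_sum_le_bound _ _ _ Sum).
  apply nnsum_le_rsum; [intro; apply rpow_pos|].
  apply (nnsum_embed s lam (fun r => rpow r p)); auto using rpow_pos, rpow_0.
  - intros mu m Hmu; apply Oc; assumption.
  - apply nnsum_le_rsum; [intro; apply rpow_pos|]. intro J.
    eapply Rle_trans; [|apply (B Tad Ad v J O)]. apply Req_le, rsum_ext; intros n _.
    rewrite NTv; symmetry; apply rpow_sqr, Pl.
Qed.

(* With [f] an eigenbasis of [T^* T], the square root [A] is the diagonal operator with
   entries [hnorm (T (f n))], and the singular values are these entries sorted. *)
Lemma in_Sp_of_ons_bound T Tad p X : separable H -> compact_op T -> adjoint T Tad -> 2 <= p ->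
  (forall u K, ons u -> rsum (fun j => rpow (nsq (T (u j))) (p / 2)) K <= X) -> in_Sp T p.
Proof.
  intros Sep CT Ad Hp Bd.
  assert (LT := proj1 CT). assert (Ads := fun x y => adjoint_sym T Tad x y Ad).
  set (P := fun x => Tad (T x)).
  assert (CP : compact_op P).
  { apply (compact_comp_l Tad T); [apply (adjoint_linear T); assumption | | assumption].
    apply (adjoint_bounded T); auto using compact_bounded. }
  assert (SP : symmetric_op P) by (intros x y; unfold P; rewrite Ads, Ad; reflexivity).
  destruct (eigenbasis_exists P CP SP) as (I & e & Oe & Ev).
  destruct (padded_of_basis e Sep Oe) as (g & f & Inj & E & Z & O & Cf).
  assert (Evf := padded_eigenbasis_of P e g f (proj1 CP) E Z Ev).
  set (mu := fun n => hnorm (T (f n))).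
  assert (Pmu : forall n, 0 <= mu n) by (intro; apply norm_pos).
  assert (CoefP : forall x n, hinner (P x) (f n) = Cmul (RtoC (mu n * mu n)) (hinner x (f n))).
  { intros x n. rewrite (eigenvec_coef P f x n SP (Evf n)). do 2 f_equal.
    unfold P, mu; rewrite Ads, norm_sqr; reflexivity. }
  assert (Un : forall n, 0 < mu n -> hinner (f n) (f n) = C1).
  { intros n Pn; destruct (proj1 O n) as [E0|U]; [|assumption].
    unfold mu, hnorm in Pn; rewrite E0, linear_zero, inner_zero_r in Pn by assumption.
    simpl in Pn; rewrite sqrt_0 in Pn; lra. }
  destruct (compact_bounded T CT) as (K & HK & BT).
  assert (Bmu : forall n, mu n * mu n <= K * K).
  { intro n. specialize (BT (f n)). fold (mu n) in BT. assert (Q := Pmu n).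
    assert (hnorm (f n) <= 1) by (apply norm_le_of_nsq; [lra|]; assert (L := ons_nsq_le1 f n O); lra).
    assert (mu n <= K) by nra. nra. }
  assert (ExA : forall x, exists w,
    hcv (lincomb (fun i => Cmul (RtoC (mu i)) (hinner x (f i))) f) w /\
    forall n, hinner w (f n) = Cmul (RtoC (mu n)) (hinner x (f n))).
  { intro x. set (c := fun i => Cmul (RtoC (mu i)) (hinner x (f i))).
    destruct (ons_series c f (K * K * nsq x) O) as (w & Hw & Cw).
    - intro n. apply Rle_trans with (rsum (fun i => (K * K) * Cn2 (hinner x (f i))) n).
      + apply rsum_le; intros i _. unfold c; rewrite Cn2_mul, Rmult_assoc, ons_coef_n2 by assumption.
        apply Rmult_le_compat_r; [apply Cn2_pos|]. specialize (Bmu i); unfold Cn2; simpl; lra.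
      + rewrite rsum_scal; apply Rmult_le_compat_l; [nra | apply bessel; assumption].
    - exists w; split; [assumption|]. intro n; rewrite Cw; unfold c.
      assert (Q := ons_coef f x n O). rewrite <- Q at 2. apply Cpx_ext; simpl; ring. }
  destruct (choice _ ExA) as [A HA].
  assert (CoefA : forall x n, hinner (A x) (f n) = Cmul (RtoC (mu n)) (hinner x (f n))) by (intro; apply HA).
  assert (LA : linear_op A).
  { split; intros; apply (complete_ext f); auto; intro n; autorewrite with inner; rewrite !CoefA;
      autorewrite with inner; apply Cpx_ext; simpl; ring. }
  assert (SA : symmetric_op A).
  { intros x y. apply (inner_limit_eq _ _ _ _ _ _ (proj1 (HA x)) (proj1 (HA y))). intro n.
    unfold lincomb; rewrite inner_hsum_l, inner_hsum_r; apply csum_ext; intros i _.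
    rewrite hinner_scal_l, inner_scal_r, (hinner_conj H y (f i)); apply Cpx_ext; simpl; ring. }
  assert (PA : forall x, 0 <= re (hinner (A x) x)).
  { intro x. destruct (hcv_inner _ _ x (proj1 (HA x))) as [Cr _].
    apply (Un_cv_ge_bound _ _ _ 0 Cr); intros n _.
    unfold lincomb; rewrite inner_hsum_l, re_csum; apply rsum_pos; intro i.
    rewrite hinner_scal_l, (hinner_conj H x (f i)); simpl. specialize (Pmu i).
    replace (_ - _) with (mu i * Cn2 (hinner x (f i))) by (unfold Cn2; ring).
    apply Rmult_le_pos; [assumption | apply Cn2_pos]. }
  assert (AA : forall x, A (A x) = Tad (T x)).
  { intro x; apply (complete_ext f); [assumption|]. intro n. rewrite !CoefA.
    fold (P x); rewrite CoefP; apply Cpx_ext; simpl; ring. }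
  assert (Af : forall n, A (f n) = hscal (RtoC (mu n)) (f n)).
  { intro n; apply (complete_ext f); [assumption|]. intro k. rewrite CoefA, hinner_scal_l.
    destruct (Nat.eq_dec n k) as [->|N]; [reflexivity|].
    rewrite (proj2 O n k N); apply Cpx_ext; simpl; ring. }
  assert (LamA : forall n, re (hinner (A (f n)) (f n)) = mu n).
  { intro n. rewrite CoefA. destruct (Pmu n) as [Q|Q].
    - rewrite Un by assumption; simpl; ring.
    - rewrite <- Q; simpl; ring. }
  assert (Smu : forall J, rsum (fun n => rpow (mu n) p) J <= X).
  { intro J. eapply Rle_trans; [|apply (Bd f J O)]. apply Req_le, rsum_ext; intros n _.
    unfold mu; rewrite <- norm_sqr; symmetry; apply rpow_sqr, norm_pos. }
  (* Boundedness of the sums of [mu^p] forces [mu] to tend to 0, as sorting requires. *)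
  destruct (decreasing_rearrangement mu Pmu) as (sg & Isg & Dsg & Ssg).
  { apply (rpow_bounded_cv0 mu p X); auto; lra. }
  exists (fun k => mu (sg k)); split.
  2:{ apply (infinite_sum_of_bounded _ X); [intro; apply rpow_pos|]. intro n.
      rewrite <- lsum_seq, <- (lsum_map sg (fun i => rpow (mu i) p)).
      apply (proj2 (nnsum_le_rsum (fun i => rpow (mu i) p) X (fun i => rpow_pos _ _)) Smu).
      apply NoDup_map_NoDup_ForallPairs; [intros i j _ _; apply Isg | apply seq_NoDup]. }
  exists Tad, A. do 5 (split; [assumption|]). split; [intro n; split; auto|].
  intros r Hr m; split.
  - intros (h & Ih & Eh). exists (fun i => f (sg (h i))); split.
    + intros i j Hi Hj. destruct (Nat.eq_dec i j) as [->|N].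
      * apply Un; rewrite Eh; assumption.
      * apply (proj2 O); intro Q; apply N, Ih; auto.
    + intros i Hi; rewrite Af, Eh by assumption; reflexivity.
  - intros (v & Ov & Vv).
    destruct (eigenvalue_occurs A f r m v SA O Cf) as (h & Ih & Eh); auto.
    { intro n; unfold eigenvec; rewrite LamA; apply Af. }
    (* Each [mu (h i)] equals [r > 0], so the sorting reaches [h i]; the index 0 chosen for [i >= m]
       is a mere default. *)
    destruct (choice (fun i k => (i < m)%nat -> sg k = h i)) as [h' Hh'].
    { intro i. destruct (Compare_dec.lt_dec i m) as [Hi|Hi]; [|exists 0%nat; easy].
      destruct (Ssg (h i)) as [k Hk]; [|exists k; auto].
      rewrite <- LamA, Eh by assumption; assumption. }
    exists h'; split.
    + intros i j Hi Hj Q; apply Ih; auto. rewrite <- !Hh' by assumption; rewrite Q; reflexivity.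
    + intros i Hi; rewrite Hh' by assumption. rewrite <- LamA; auto.
Qed.

End Schatten.

Theorem theorem12 :
  forall p : R, 2 <= p ->
  exists c : R, 0 < c /\
  forall (H : HilbertSpace) (T : H -> H),
    separable H -> compact_op T ->
    (* (a) <-> (b) *)
    (in_Sp T p <->
       (forall (I : Type) (e : I -> H), orthonormal_basis e ->
          nnsum_finite (matrix_p T e p))) /\
    (* (a) <-> (c) *)
    (in_Sp T p <->
       (forall f : nat -> H, is_frame f -> nnsum_finite (matrix_p T f p))) /\
    (* norm inequalities; N = ||T||_p^p *)
    (forall (s : nat -> R) (N : R),
       singular_values T s -> infinite_sum (fun n => rpow (s n) p) N ->
       (* c ||T||_p^p <= sup over orthonormal bases *)
       (forall M, (forall (I : Type) (e : I -> H), orthonormal_basis e ->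
                     nnsum_le (matrix_p T e p) M) -> c * N <= M) /\
       (* sup over orthonormal bases <= sup over frames with upper bound <= 1 *)
       (forall M, (forall f : nat -> H, is_frame f -> upper_frame_bound_le f 1 ->
                     nnsum_le (matrix_p T f p) M) ->
                  (forall (I : Type) (e : I -> H), orthonormal_basis e ->
                     nnsum_le (matrix_p T e p) M)) /\
       (* sup over frames with upper bound <= 1 <= ||T||_p^p *)
       (forall f : nat -> H, is_frame f -> upper_frame_bound_le f 1 ->
          nnsum_le (matrix_p T f p) N)).
Proof.
  intros p Hp. assert (P4 : 0 < rpow 4 (p / 2)) by (apply rpow_lt0; lra).
  exists (/ rpow 4 (p / 2)); split; [apply Rinv_0_lt_compat; assumption|].
  intros H T Sep CT.
  assert (ac : in_Sp T p -> forall f : nat -> H, is_frame f -> nnsum_finite (matrix_p T f p)).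
  { intros (s & SV & N & Sum) f (c1 & C & Hc1 & HC & Fr).
    exists (rpow C (p / 2) * (rpow C (p / 2) * N)).
    apply (bessel_matrix_bound T s p N C f); auto; [lra|].
    intros z K; apply admissible_bessel. intro x. destruct (Fr x) as (L & HL & _ & B). exists L; auto. }
  assert (cb : (forall f : nat -> H, is_frame f -> nnsum_finite (matrix_p T f p)) ->
     forall (I : Type) (e : I -> H), orthonormal_basis e -> nnsum_finite (matrix_p T e p)).
  (* Padding makes the basis a Parseval frame over [nat], whose matrix contains that of [e] along
     the injection [g]. *)
  { intros c I e Oe. destruct (padded_of_basis e Sep Oe) as (g & f & Inj & E & _ & O & Cf).
    destruct (c f (padded_is_frame f O Cf)) as [M HM]; exists M.
    apply (nnsum_le_pullback T e f g); assumption. }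
  assert (ba : (forall (I : Type) (e : I -> H), orthonormal_basis e ->
     nnsum_finite (matrix_p T e p)) -> in_Sp T p).
  { intro b. destruct (adjoint_exists T Sep CT) as [Tad Ad].
    destruct (cartesian_control T Tad p Sep CT Ad Hp) as (I1 & e1 & I2 & e2 & O1 & O2 & B).
    destruct (b I1 e1 O1) as [M1 H1]. destruct (b I2 e2 O2) as [M2 H2].
    apply (in_Sp_of_ons_bound T Tad p (rpow 4 (p / 2) * (M1 + M2) / 2)); auto.
    intros u K Ou. specialize (B M1 M2 H1 H2 u K Ou). lra. }
  split; [split; auto|]. split; [split; auto|].
  intros s N SV Sum. split; [|split].
  (* The same [M] serves both eigenbases, so the left factor 2 cancels against [M + M]. *)
  - intros M HM. assert (N <= rpow 4 (p / 2) * M) as L.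
    { apply (singular_sum_le T s p N); auto. intros Tad Ad u K Ou.
      destruct (cartesian_control T Tad p Sep CT Ad Hp) as (I1 & e1 & I2 & e2 & O1 & O2 & B).
      specialize (B M M (HM I1 e1 O1) (HM I2 e2 O2) u K Ou). lra. }
    apply (Rmult_le_reg_l (rpow 4 (p / 2))); [assumption|]. rewrite <- Rmult_assoc, Rinv_r by lra. lra.
  - intros M HM I e Oe. destruct (padded_of_basis e Sep Oe) as (g & f & Inj & E & _ & O & Cf).
    apply (nnsum_le_pullback T e f g); auto.
    apply HM; [apply padded_is_frame | apply padded_upper_bound]; assumption.
  - intros f _ Up.
    replace N with (rpow 1 (p / 2) * (rpow 1 (p / 2) * N)).
    + apply (bessel_matrix_bound T s p N 1 f); auto; [lra|].
      intros z K; apply upper_frame_bound_bessel; assumption.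
    + rewrite rpow_gt0 by lra. unfold Rpower; rewrite ln_1, Rmult_0_r, exp_0; ring.
Qed.
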